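(* Assume that $g(x,y)>0$ for all $(x,y)\in\mathsf X\times\mathsf Y$, and that for every $\eta>0$ there exists an LD-set function $\mathsf C_\eta$ such that $\Upsilon_{\mathsf C_\eta(y)^c}(y)\le \eta\,\Upsilon_{\mathsf X}(y)$ for all $y\in\mathsf Y$; for each $\eta>0$ fix such a $\mathsf C_\eta$ and let $\Lambda_\eta$ be defined from it as in the context. Let $\{Y_k\}_{k\ge0}$ be a $\mathsf Y$-valued stochastic process on $(\Omega,\mathcal F,\mathbb P_\star)$. Assume that there exist an LD-set function $\mathsf C$ and a constant $M>0$ such that, $\mathbb P_\star$-a.s., $$\liminf_{n\to\infty} n^{-1}\sum_{k=2}^n\log\varepsilon^-_{\mathsf C}(Y_{k-1},Y_k)>-M,$$ $$\limsup_{n\to\infty} n^{-1}\sum_{k=0}^n\log\Upsilon_{\mathsf X}(Y_k)<M,$$ $$\liminf_{n\to\infty} n^{-1}\sum_{k=2}^n\log\Psi_{\mathsf C}(Y_{k-1},Y_k)>-M .$$ Assume in addition that, for all $\eta>0$ and $\alpha\in(0,1)$, $$\limsup_{n\to\infty} n^{-1}\log\Lambda_\eta(Y_{0:n},\alpha)<0\qquad \mathbb P_\star\text{-a.s.}$$ Then, for any probability measures $\nu$ and $\nu'$ on $(\mathsf X,\mathcal X)$ such that $\nu Q\mathbf 1_{\mathsf C(Y_1)}>0$ $\mathbb P_\star$-a.s. and $\nu' Q\mathbf 1_{\mathsf C(Y_1)}>0$ $\mathbb P_\star$-a.s., where $\nu Q\mathbf 1_{A}=\int\nu(dx)Q(x,A)$,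 one has $$\limsup_{n\to\infty} n^{-1}\log\big\|\phi_{\nu,n}[Y_{0:n}]-\phi_{\nu',n}[Y_{0:n}]\big\|_{\mathrm{TV}}<0\qquad \mathbb P_\star\text{-a.s.}$$
   Context: Setting. $(\mathsf X,\mathcal X)$ and $(\mathsf Y,\mathcal Y)$ are measurable spaces with countably generated $\sigma$-fields, $Q$ is a Markov transition kernel on $(\mathsf X,\mathcal X)$, $G$ is a Markov transition kernel from $(\mathsf X,\mathcal X)$ to $(\mathsf Y,\mathcal Y)$, and there is a measure $\mu$ on $(\mathsf Y,\mathcal Y)$ such that $G(x,\cdot)$ has density $g(x,\cdot)$ with respect to $\mu$ for every $x\in\mathsf X$. For a probability measure $\nu$ on $(\mathsf X,\mathcal X)$ and $y_{0:n}=(y_0,\dots,y_n)\in\mathsf Y^{n+1}$, the filtering distribution is $$\phi_{\nu,n}[y_{0:n}](A)=\frac{\int_{\mathsf X^{n+1}}\nu(dx_0)g(x_0,y_0)\prod_{i=1}^nQ(x_{i-1},dx_i)g(x_i,y_i)\mathbf 1_A(x_n)}{\int_{\mathsf X^{n+1}}\nu(dx_0)g(x_0,y_0)\prod_{i=1}^nQ(x_{i-1},dx_i)g(x_i,y_i)},\quad A\in\mathcal X .$$ The process $\{Y_k\}$ at which the filter is evaluated need not be related to the kernels $Q,G$. $\|\cdot\|_{\mathrm{TV}}$ is the total variation norm. LD-set function: a map $\mathsf C:\mathsf Y\to\mathcal X$ is a local Doeblin set function (LD-set function) if there is a map $(y,y')\mapsto(\varepsilon^-_{\mathsf C}(y,y'),\varepsilon^+_{\mathsf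 C}(y,y'))$ from $\mathsf Y\times\mathsf Y$ to $(0,\infty)^2$ and, for all $(y,y')\in\mathsf Y\times\mathsf Y$, a measure $\lambda_{y,y'}$ on $(\mathsf X,\mathcal X)$ such that $$\varepsilon^-_{\mathsf C}(y,y')\lambda_{y,y'}[A\cap\mathsf C(y')]\le Q[x,A\cap\mathsf C(y')]\le\varepsilon^+_{\mathsf C}(y,y')\lambda_{y,y'}[A\cap\mathsf C(y')]$$ for all $x\in\mathsf C(y)$ and $A\in\mathcal X$. Each LD-set function is considered together with a fixed choice of $\varepsilon^\pm_{\mathsf C}$ and $\lambda_{y,y'}$. Notation: for $A\in\mathcal X$, $\Upsilon_A(y)=\sup_{x\in A}g(x,y)$, and $A^c$ is the complement of $A$ in $\mathsf X$. For an LD-set function $\mathsf C$, $\Psi_{\mathsf C}(y,y')=\int_{\mathsf C(y')}g(x,y')\,\lambda_{y,y'}(dx)$ and $\rho_{\mathsf C}(y,y')=1-\big(\varepsilon^-_{\mathsf C}(y,y')/\varepsilon^+_{\mathsf C}(y,y')\big)^2$. For $\alpha\in(0,1)$, $$\Lambda_\eta(y_{0:n},\alpha)=\max\Big\{\prod_{k=1}^n\rho_{\mathsf C_\eta}(y_{k-1},y_k)^{\delta_k}:\ \{\delta_k\}_{k=1}^n\in\{0,1\}^n,\ \sum_{k=1}^n\delta_k\ge\alpha n\Big\}.$$ *)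

(* Defs.v *)
From HB Require Import structures.
From mathcomp Require Import all_boot all_order all_algebra.
From mathcomp Require Import all_classical all_reals all_analysis.
From mathcomp Require Import measurable_realfun.

Set Implicit Arguments.
Unset Strict Implicit.
Unset Printing Implicit Defensive.
Import Order.TTheory GRing.Theory Num.Theory.
Import numFieldNormedType.Exports.

Local Open Scope classical_set_scope.
Local Open Scope ring_scope.
Local Open Scope ereal_scope.

Definition countably_generated d (T : measurableType d) :=
  exists F : nat -> set T, @measurable d T = <<s range F >>.

(* Measurability of [g ^~ y] is needed for the integrals in the filter to be
   meaningful; joint measurability is not required. *)
Record transition_density (R : realType) dX dY (X : measurableType dX)
    (Y : measurableType dY) (G : R.-pker X ~> Y)
    (mu : {measure set Y -> \bar R}) := TransitionDensity {
  density :> X -> Y -> R ;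
  density_ge0 : forall x y, (0 <= density x y)%R ;
  measurable_density_l : forall y, measurable_fun [set: X] (density ^~ y) ;
  measurable_density_r : forall x, measurable_fun [set: Y] (density x) ;
  densityE : forall x B, measurable B ->
    G x B = \int[mu]_(y in B) (density x y)%:E }.

(* A local Doeblin set function bundled with its constants and measures. *)
Record LD_set_function (R : realType) dX (X : measurableType dX) (Y : Type)
    (Q : R.-pker X ~> X) := LDSetFunction {
  LD_set :> Y -> set X ;
  LD_measurable : forall y, measurable (LD_set y) ;
  LD_em : Y -> Y -> R ;
  LD_ep : Y -> Y -> R ;
  LD_em_gt0 : forall y y', (0 < LD_em y y')%R ;
  LD_ep_gt0 : forall y y', (0 < LD_ep y y')%R ;
  LD_lambda : Y -> Y -> {measure set X -> \bar R} ;
  LD_bounds : forall y y' x A, LD_set y x -> measurable A ->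
    (LD_em y y')%:E * LD_lambda y y' (A `&` LD_set y')
      <= Q x (A `&` LD_set y')
      <= (LD_ep y y')%:E * LD_lambda y y' (A `&` LD_set y') }.

(* The total mass |nu|(T) of the variation of a finite signed measure; it does
   not depend on the chosen Hahn decomposition. *)
Definition tv_norm (R : realType) d (T : measurableType d)
    (nu : {charge set T -> \bar R}) : \bar R :=
  let hP := cid (Hahn_decomposition nu) in
  let hN := cid (svalP hP) in
  charge_variation (svalP hN) [set: T].

Section filter.
Context (R : realType) dX dY (X : measurableType dX) (Y : measurableType dY).
Context (Q : R.-pker X ~> X) (G : R.-pker X ~> Y).
Context (mu : {measure set Y -> \bar R}) (g : transition_density G mu).

(* int Q(x_0,dx_1) g(x_1,y_1) ... int Q(x_{n-1},dx_n) g(x_n,y_n) f(x_n) *)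
Fixpoint tail_integral (f : X -> \bar R) (y : nat -> Y) (n : nat) (x0 : X)
    : \bar R :=
  if n is m.+1 then
    \int[Q x0]_x1 ((g x1 (y 1%N))%:E * tail_integral f (fun k => y k.+1) m x1)
  else f x0.

Lemma tail_integral_ge0 (f : X -> \bar R) (y : nat -> Y) n x :
  (forall x, 0 <= f x) -> 0 <= tail_integral f y n x.
Proof.
move=> f0; elim: n y x => [|n IH] y x //=.
by apply: integral_ge0 => x1 _; rewrite mule_ge0// lee_fin density_ge0.
Qed.

Lemma measurable_tail_integral (f : X -> \bar R) (y : nat -> Y) n :
  (forall x, 0 <= f x) -> measurable_fun [set: X] f ->
  measurable_fun [set: X] (tail_integral f y n).
Proof.
move=> f0 mf; elim: n y => [|n IH] y //=.
apply: (measurable_fun_integral_finite_kernel (fun z : X * X =>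
  (g z.2 (y 1%N))%:E * tail_integral f (fun k => y k.+1) n z.2) Q).
  move=> z; rewrite mule_ge0// ?lee_fin ?density_ge0//.
  exact: tail_integral_ge0.
apply: emeasurable_funM.
  apply/measurable_EFinP.
  exact: (measurableT_comp (measurable_density_l g _) measurable_snd).
exact: (measurableT_comp (IH _) measurable_snd).
Qed.

Variables (nu : probability X R) (y : nat -> Y) (n : nat).

(* The numerator of the filter; the denominator is its value at [setT]. *)
Definition unnormalized_filter (A : set X) : \bar R :=
  \int[nu]_x0 ((g x0 (y 0%N))%:E * tail_integral (EFin \o \1_A) y n x0).

Let indic_ge0 (A : set X) x : 0 <= (EFin \o \1_A) x :> \bar R.
Proof. by rewrite lee_fin indicE. Qed.

Let measurable_indicE (A : set X) : measurable A ->
  measurable_fun [set: X] (EFin \o \1_A : X -> \bar R).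
Proof. by move=> mA; apply/measurable_EFinP. Qed.

Lemma tail_integral_nneseries (f : nat -> X -> \bar R) (z : nat -> Y) m x :
  (forall i x, 0 <= f i x) -> (forall i, measurable_fun [set: X] (f i)) ->
  tail_integral (fun x => \sum_(0 <= i <oo) f i x) z m x =
  \sum_(0 <= i <oo) tail_integral (f i) z m x.
Proof.
move=> f0 mf; elim: m z x => [|m IH] z x //=.
rewrite -integral_nneseries//; last 2 first.
- move=> i; apply: emeasurable_funM; last exact: measurable_tail_integral.
  by apply/measurable_EFinP; exact: measurable_density_l.
- move=> i x1 _; rewrite mule_ge0 ?lee_fin ?density_ge0//.
  exact: tail_integral_ge0.
apply: eq_integral => x1 _; rewrite IH -nneseriesZl ?lee_fin ?density_ge0//.
by move=> i _; exact: tail_integral_ge0.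
Qed.

Let unnormalized_filter0 : unnormalized_filter set0 = 0.
Proof.
have t0 z m x : tail_integral (EFin \o \1_(set0 : set X)) z m x = 0.
  elim: m z x => [|m IH] z x /=; first by rewrite indicE in_set0.
  by apply: integral0_eq => x1 _; rewrite IH mule0.
by apply: integral0_eq => x _; rewrite t0 mule0.
Qed.

Let unnormalized_filter_ge0 A : 0 <= unnormalized_filter A.
Proof.
apply: integral_ge0 => x _; rewrite mule_ge0 ?lee_fin ?density_ge0//.
exact: tail_integral_ge0.
Qed.

Let unnormalized_filter_sigma_additive : semi_sigma_additive unnormalized_filter.
Proof.
move=> F mF tF mUF.
have -> : unnormalized_filter (\bigcup_i F i) =
    \sum_(0 <= i <oo) unnormalized_filter (F i).
  rewrite /unnormalized_filter -integral_nneseries//; last 2 first.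
  - move=> i; apply: emeasurable_funM.
      by apply/measurable_EFinP; exact: measurable_density_l.
    by apply: measurable_tail_integral => //; exact: measurable_indicE.
  - move=> i x1 _; rewrite mule_ge0 ?lee_fin ?density_ge0//.
    exact: tail_integral_ge0.
  apply: eq_integral => x _.
  rewrite (_ : EFin \o \1_(\bigcup_i F i) =
      (fun x => \sum_(0 <= i <oo) (EFin \o \1_(F i)) x)).
    rewrite tail_integral_nneseries//; last by move=> i; exact: measurable_indicE.
    rewrite -nneseriesZl ?lee_fin ?density_ge0// => i _.
    exact: tail_integral_ge0.
  by apply/funext => z /=; rewrite indic_bigcup.
by apply: is_cvg_nneseries.
Qed.

HB.instance Definition _ := isMeasure.Build _ _ _ unnormalized_filter
  unnormalized_filter0 unnormalized_filter_ge0
  unnormalized_filter_sigma_additive.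

(* phi_{nu,n}[y_{0:n}]. When the normalizing constant is 0 or +oo, in which case
   the quotient is undefined, [mnormalize] returns [nu] by convention. *)
Definition filtering : set X -> \bar R := mnormalize unnormalized_filter nu.

HB.instance Definition _ := Probability.on filtering.

End filter.

(* phi_{nu,n}[y_{0:n}] - phi_{nu',n}[y_{0:n}], as a finite signed measure. *)
Definition filtering_diff (R : realType) dX dY (X : measurableType dX)
    (Y : measurableType dY) (Q : R.-pker X ~> X) (G : R.-pker X ~> Y)
    (mu : {measure set Y -> \bar R}) (g : transition_density G mu)
    (nu nu' : probability X R) (y : nat -> Y) (n : nat)
    : {charge set X -> \bar R} :=
  cadd (charge_of_finite_measure (filtering Q g nu y n))
       (copp (charge_of_finite_measure (filtering Q g nu' y n))).

(* The supremum is -oo when [A] is empty. *)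
Definition Upsilon (R : realType) (X Y : Type) (g : X -> Y -> R) (A : set X)
    (y : Y) : \bar R :=
  ereal_sup [set (g x y)%:E | x in A].

Definition Psi (R : realType) dX (X : measurableType dX) (Y : Type)
    (Q : R.-pker X ~> X) (g : X -> Y -> R) (C : LD_set_function Y Q)
    (y y' : Y) : \bar R :=
  \int[LD_lambda C y y']_(x in C y') (g x y')%:E.

Definition rho (R : realType) dX (X : measurableType dX) (Y : Type)
    (Q : R.-pker X ~> X) (C : LD_set_function Y Q) (y y' : Y) : R :=
  (1 - (LD_em C y y' / LD_ep C y y') ^+ 2)%R.

(* The index [k : 'I_n] stands for the transition from y_k to y_(k+1). The
   value is finite for alpha <= 1, since the constant family 1 is admissible. *)
Definition Lambda (R : realType) dX (X : measurableType dX) (Y : Type)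
    (Q : R.-pker X ~> X) (C : LD_set_function Y Q) (y : nat -> Y) (n : nat)
    (alpha : R) : \bar R :=
  \big[maxe/-oo]_(delta : {ffun 'I_n -> bool} |
      (alpha * n%:R <= (\sum_(k < n) delta k)%N%:R)%R)
    (\prod_(k < n) rho C (y k) (y k.+1) ^+ delta k)%R%:E.

(* Main.v *)
Require Import Defs.
From HB Require Import structures.
From mathcomp Require Import all_boot all_order all_algebra.
From mathcomp Require Import all_classical all_reals all_analysis.
From mathcomp Require Import measurable_realfun.
From mathcomp Require Import ring lra zify.

Set Implicit Arguments.
Unset Strict Implicit.
Unset Printing Implicit Defensive.
Import Order.TTheory GRing.Theory Num.Theory.
Import numFieldNormedType.Exports.

Local Open Scope classical_set_scope.
Local Open Scope ring_scope.
Local Open Scope ereal_scope.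

(** Fix a trajectory y of the observations and run two copies of the hidden chain
    side by side, from nu and nu'. The difference of the two filters at A, multiplied
    by the product of the two normalizing masses, is the integral of the
    antisymmetric function 1_A(x_n) - 1_A(x'_n) against the weighted pair of chains.
    On a transition during which both copies stay in the local Doeblin sets, the pair
    of kernels dominates (e^-)^2 times the symmetric measure lambda (x) lambda, which
    integrates an antisymmetric function to 0; what is left is at most a fraction
    rho = 1 - (e^-/e^+)^2 of the pair of kernels ([doeblin_swap]). A transition that
    is not of this kind has a copy outside the Doeblin set at one of its two ends,
    where the likelihood is at most eta = kappa^2 times its supremum.

    Induction on the time horizon n ([tail_swap]) separates, for any threshold s, the
    trajectories with at least s good transitions from the others: the gap between
    the filters is at most
      max (prod of rho over the good transitions)
        + kappa^(n - s) (prod of the suprema)^2 / (product of the two masses).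
    With s = n/2 the first term is bounded by Lambda_eta(y, 1/2), which decays
    exponentially by assumption. In the second term the masses are bounded below
    ([mass_lower_bound]) by forcing the chain to follow the sets C(y_k), which gives
    prod (e^- Psi); so the masses and the suprema contribute at most exp((6 M + 2) n),
    and kappa = exp(-(12 M + 8)) overcomes that ([rare_visits_rate]). *)

(** * Comparison of integrals *)

Section integral_comparison.
Context d (T : measurableType d) (R : realType).

Import HBNNSimple.

(** The Doeblin condition orders two measures only after restriction to [C]. *)
Lemma ge0_le_measure_integral_on (m1 m2 : {measure set T -> \bar R})
    (C : set T) (f : T -> \bar R) :
  measurable C ->
  (forall A, measurable A -> m1 (A `&` C) <= m2 (A `&` C)) ->
  (forall x, C x -> 0 <= f x) -> measurable_fun C f ->
  \int[m1]_(x in C) f x <= \int[m2]_(x in C) f x.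
Proof.
move=> mC m12 f0 mf; rewrite !ge0_integralE//= ge_ereal_sup// => _ [h/= hf] <-.
apply: le_ereal_sup_tmp; exists (sintegral m2 h); first by exists h.
rewrite !sintegralE lee_fsum// => r [t _ <-].
(* A nonzero level set of a simple function below f \_ C lies inside C. *)
have [->|h0] := eqVneq (h t) 0%R; first by rewrite !mul0e.
have hC : h @^-1` [set h t] `<=` C.
  move=> x /= hx; apply: contrapT => nCx.
  have := hf x; rewrite /patch memNset// lee_fin hx => ht0.
  by move/negP: h0; apply; rewrite eq_le ht0 /=; exact: fun_ge0.
rewrite lee_pmul ?lee_fin//.
by rewrite -(setIidl hC) m12.
Qed.

Lemma le_scale_measure_integral_on (m1 m2 : {measure set T -> \bar R})
    (k1 k2 : R) (C : set T) (f : T -> \bar R) :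
  (0 <= k1)%R -> (0 <= k2)%R -> measurable C ->
  (forall A, measurable A -> k1%:E * m1 (A `&` C) <= k2%:E * m2 (A `&` C)) ->
  (forall x, C x -> 0 <= f x) -> measurable_fun C f ->
  k1%:E * \int[m1]_(x in C) f x <= k2%:E * \int[m2]_(x in C) f x.
Proof.
move=> k10 k20 mC m12 f0 mf.
rewrite -[k1]/((NngNum k10)%:num%R) -[k2]/((NngNum k20)%:num%R).
rewrite -!ge0_integral_mscale//.
by apply: ge0_le_measure_integral_on.
Qed.

Lemma Rintegral_affine (m : {measure set T -> \bar R}) (C : set T)
    (f g : T -> R) (a b c : R) :
  measurable C -> m C < +oo ->
  m.-integrable C (EFin \o f) -> m.-integrable C (EFin \o g) ->
  m.-integrable C (EFin \o (fun x => f x * a + g x * b + c)%R) /\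
  (\int[m]_(x in C) (f x * a + g x * b + c) =
   \int[m]_(x in C) f x * a + \int[m]_(x in C) g x * b + c * fine (m C))%R.
Proof.
move=> mC Coo fi gi.
have fa : m.-integrable C (EFin \o (fun x => f x * a)%R).
  rewrite (_ : _ \o _ = (fun x => (EFin \o f) x * a%:E)); last by apply/funext.
  exact: integrableZr.
have gb : m.-integrable C (EFin \o (fun x => g x * b)%R).
  rewrite (_ : _ \o _ = (fun x => (EFin \o g) x * b%:E)); last by apply/funext.
  exact: integrableZr.
have fg : m.-integrable C (EFin \o (fun x => f x * a + g x * b)%R).
  rewrite (_ : _ \o _ = (EFin \o (fun x => f x * a)%R) \+
    (EFin \o (fun x => g x * b)%R)); last by apply/funext.
  exact: integrableD.
have ci : m.-integrable C (EFin \o cst c).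
  by apply: measurable_bounded_integrable => //; exact: bounded_cst.
split.
  rewrite (_ : _ \o _ = (EFin \o (fun x => f x * a + g x * b)%R) \+
    (EFin \o cst c)); last by apply/funext.
  exact: integrableD.
by rewrite RintegralD// RintegralD// !RintegralZr// Rintegral_cst.
Qed.

End integral_comparison.

(** * Integrals of antisymmetric functions over pairs *)

Section antisymmetric_integrals.
Context d (X : measurableType d) (R : realType).
Local Open Scope ring_scope.

(** Integrate the pointwise inequality in x' with x fixed, then in x: each of its
    terms is a product of a function of x and a function of x'. *)
Lemma swap_rectangle (p q : {measure set X -> \bar R}) (A B : set X)
    (U V : X -> R) (r c : R) :
  measurable A -> measurable B -> (p A < +oo)%E -> (q B < +oo)%E ->
  p.-integrable A (EFin \o U) -> p.-integrable A (EFin \o V) ->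
  q.-integrable B (EFin \o U) -> q.-integrable B (EFin \o V) ->
  (forall x x', A x -> B x' ->
    U x * V x' <= V x * U x' + r * V x * V x' + c) ->
  (\int[p]_(x in A) U x) * (\int[q]_(x in B) V x) <=
  (\int[p]_(x in A) V x) * (\int[q]_(x in B) U x)
  + r * (\int[p]_(x in A) V x) * (\int[q]_(x in B) V x)
  + c * fine (p A) * fine (q B).
Proof.
move=> mA mB pA qB pU pV qU qV UV.
have inner x : A x -> 0 <= V x * (\int[q]_(x in B) U x + r * \int[q]_(x in B) V x)
    + U x * (- \int[q]_(x in B) V x) + c * fine (q B).
  move=> Ax; have [i e] := Rintegral_affine (V x) (r * V x - U x) c mB qB qU qV.
  have := @Rintegral_ge0 _ _ _ q B
    (fun x' => U x' * V x + V x' * (r * V x - U x) + c).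
  rewrite e => h.
  suff : 0 <= \int[q]_(x0 in B) U x0 * V x +
      \int[q]_(x0 in B) V x0 * (r * V x - U x) + c * fine (q B) by lra.
  by apply: h => x' Bx'; have := UV _ _ Ax Bx'; lra.
have [i e] := Rintegral_affine
  (\int[q]_(x in B) U x + r * \int[q]_(x in B) V x) (- \int[q]_(x in B) V x)
  (c * fine (q B)) mA pA pV pU.
have := Rintegral_ge0 p inner; rewrite e; lra.
Qed.

Lemma le_scale_affine (m1 m2 : {measure set X -> \bar R}) (k1 k2 : R)
    (C : set X) (f g : X -> R) (a b c : R) :
  0 <= k1 -> 0 <= k2 ->
  measurable C -> (m1 C < +oo)%E -> (m2 C < +oo)%E ->
  m1.-integrable C (EFin \o f) -> m1.-integrable C (EFin \o g) ->
  m2.-integrable C (EFin \o f) -> m2.-integrable C (EFin \o g) ->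
  (forall A, measurable A -> k1%:E * m1 (A `&` C) <= k2%:E * m2 (A `&` C))%E ->
  (forall x, C x -> 0 <= f x * a + g x * b + c) ->
  k1 * (\int[m1]_(x in C) f x * a + \int[m1]_(x in C) g x * b + c * fine (m1 C))
  <= k2 * (\int[m2]_(x in C) f x * a + \int[m2]_(x in C) g x * b
           + c * fine (m2 C)).
Proof.
move=> k10 k20 mC m1C m2C f1 g1 f2 g2 m12 h0.
have [i1 e1] := Rintegral_affine a b c mC m1C f1 g1.
have [i2 e2] := Rintegral_affine a b c mC m2C f2 g2.
rewrite -e1 -e2 -lee_fin !EFinM !fineK; last 2 first.
- exact: integrable_fin_num.
- exact: integrable_fin_num.
apply: le_scale_measure_integral_on => //.
by have /measurable_int := i1.
Qed.

(** The gain of the Doeblin condition. By hypothesis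
    h(x, x') = V(x) U(x') - U(x) V(x') + r V(x) V(x') + c is nonnegative on C x C, so
    p (x) q integrates it to at least em^2 times its integral against l (x) l. There
    the antisymmetric part vanishes, and the integral of r V V + c against l (x) l
    is at least ep^(-2) times its integral against p (x) q. *)
Lemma doeblin_swap (p q l : {measure set X -> \bar R}) (C : set X)
    (em ep : R) (U V : X -> R) (r c : R) :
  0 < em -> 0 < ep -> 0 <= r -> 0 <= c ->
  measurable C -> (p C < +oo)%E -> (q C < +oo)%E -> (l C < +oo)%E ->
  p.-integrable C (EFin \o U) -> p.-integrable C (EFin \o V) ->
  q.-integrable C (EFin \o U) -> q.-integrable C (EFin \o V) ->
  l.-integrable C (EFin \o U) -> l.-integrable C (EFin \o V) ->
  (forall A, measurable A -> em%:E * l (A `&` C) <= p (A `&` C)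
                               <= ep%:E * l (A `&` C))%E ->
  (forall A, measurable A -> em%:E * l (A `&` C) <= q (A `&` C)
                               <= ep%:E * l (A `&` C))%E ->
  (forall x, C x -> 0 <= V x) ->
  (forall x x', C x -> C x' ->
    U x * V x' <= V x * U x' + r * V x * V x' + c) ->
  (\int[p]_(x in C) U x) * (\int[q]_(x in C) V x) <=
  (\int[p]_(x in C) V x) * (\int[q]_(x in C) U x)
  + (1 - (em / ep) ^+ 2) * (r * (\int[p]_(x in C) V x) * (\int[q]_(x in C) V x)
     + c * fine (p C) * fine (q C)).
Proof.
move=> em0 ep0 r0 c0 mC pC qC lC pU pV qU qV lU lV pl ql V0 UV.
(* The integral of h(x, _) against l: its nonnegativity is used for the outer
   integral. *)
have fq x : C x -> 0 <= V x * (\int[l]_(x in C) U x + r * \int[l]_(x in C) V x)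
    + U x * (- \int[l]_(x in C) V x) + c * fine (l C).
  move=> Cx; have [i e] := Rintegral_affine (V x) (r * V x - U x) c mC lC lU lV.
  have : 0 <= \int[l]_(x' in C) (U x' * V x + V x' * (r * V x - U x) + c).
    by apply: Rintegral_ge0 => x' Cx'; have := UV _ _ Cx Cx'; lra.
  rewrite e; lra.
have pl1 A : measurable A -> (em%:E * l (A `&` C) <= 1%:E * p (A `&` C))%E.
  by move=> /pl/andP[+ _]; rewrite mul1e.
have ql1 A : measurable A -> (em%:E * l (A `&` C) <= 1%:E * q (A `&` C))%E.
  by move=> /ql/andP[+ _]; rewrite mul1e.
have pl2 A : measurable A -> (1%:E * p (A `&` C) <= ep%:E * l (A `&` C))%E.
  by move=> /pl/andP[_]; rewrite mul1e.
have ql2 A : measurable A -> (1%:E * q (A `&` C) <= ep%:E * l (A `&` C))%E.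
  by move=> /ql/andP[_]; rewrite mul1e.
(* q integrates h(x, _) to at least em times what l does. *)
have inner x : C x -> 0 <=
    V x * (\int[q]_(x in C) U x + r * \int[q]_(x in C) V x
      - em * (\int[l]_(x in C) U x + r * \int[l]_(x in C) V x))
    + U x * (em * \int[l]_(x in C) V x - \int[q]_(x in C) V x)
    + c * (fine (q C) - em * fine (l C)).
  move=> Cx.
  have pos x' : C x' -> 0 <= U x' * V x + V x' * (r * V x - U x) + c.
    by move=> Cx'; have := UV _ _ Cx Cx'; lra.
  have := le_scale_affine (ltW em0) ler01 mC lC qC lU lV qU qV ql1 pos; lra.
have [_ e] := Rintegral_affine
  (\int[q]_(x in C) U x + r * \int[q]_(x in C) V x
      - em * (\int[l]_(x in C) U x + r * \int[l]_(x in C) V x))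
  (em * \int[l]_(x in C) V x - \int[q]_(x in C) V x)
  (c * (fine (q C) - em * fine (l C))) mC pC pV pU.
have := Rintegral_ge0 p inner; rewrite {}e => h1.
have h2 := le_scale_affine (ltW em0) ler01 mC lC pC lV lU pV pU pl1 fq.
have le_ep (m : {measure set X -> \bar R}) (f : X -> R) :
    (m C < +oo)%E -> m.-integrable C (EFin \o f) -> l.-integrable C (EFin \o f) ->
    (forall x, C x -> 0 <= f x) ->
    (forall A, measurable A -> 1%:E * m (A `&` C) <= ep%:E * l (A `&` C))%E ->
    \int[m]_(x in C) f x <= ep * \int[l]_(x in C) f x.
  move=> mC' fm fl f0 ml.
  have := le_scale_affine (a := 1) (b := 0) (c := 0)
    ler01 (ltW ep0) mC mC' lC fm fm fl fl ml.
  rewrite mul1r !mulr1 !mulr0 !mul0r !addr0; apply => x /f0.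
  by rewrite mulr1 mulr0 !addr0.
have pVl := le_ep p V pC pV lV V0 pl2.
have qVl := le_ep q V qC qV lV V0 ql2.
have fin (m : {measure set X -> \bar R}) :
    (m C < +oo)%E -> m C = (fine (m C))%:E.
  by move=> mCoo; rewrite fineK// ge0_fin_numE.
have mass (m : {measure set X -> \bar R}) : (m C < +oo)%E ->
    (forall A, measurable A -> 1%:E * m (A `&` C) <= ep%:E * l (A `&` C))%E ->
    fine (m C) <= ep * fine (l C).
  move=> mCoo /(_ setT measurableT); rewrite setTI mul1e.
  by rewrite (fin m mCoo) (fin l lC) -EFinM lee_fin.
have p1l := mass p pC pl2.
have q1l := mass q qC ql2.
have pV0 : 0 <= \int[p]_(x in C) V x by apply: Rintegral_ge0.
have qV0 : 0 <= \int[q]_(x in C) V x by apply: Rintegral_ge0.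
have p10 : 0 <= fine (p C) by exact: fine_ge0.
have q10 : 0 <= fine (q C) by exact: fine_ge0.
have VV : \int[p]_(x in C) V x * \int[q]_(x in C) V x <=
    ep ^+ 2 * (\int[l]_(x in C) V x) ^+ 2.
  by apply: le_trans (ler_pM pV0 qV0 pVl qVl) _; rewrite -exprMn expr2.
have CC : fine (p C) * fine (q C) <= ep ^+ 2 * (fine (l C)) ^+ 2.
  by apply: le_trans (ler_pM p10 q10 p1l q1l) _; rewrite -exprMn expr2.
have h3 : (em / ep) ^+ 2 *
    (r * (\int[p]_(x in C) V x) * (\int[q]_(x in C) V x)
     + c * fine (p C) * fine (q C)) <=
    em ^+ 2 * (r * (\int[l]_(x in C) V x) ^+ 2 + c * fine (l C) ^+ 2).
  rewrite exprMn exprVn -[leLHS]mulrA ler_wpM2l ?sqr_ge0//.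
  rewrite ler_pdivrMl ?exprn_gt0//.
  have := ler_wpM2l r0 VV; have := ler_wpM2l c0 CC; lra.
have h4 := ler_wpM2l (ltW em0) h2.
rewrite mulrBl mul1r.
move: h1 h3 h4; rewrite !mul1r.
move: (\int[p]_(x in C) V x) (\int[q]_(x in C) V x) (\int[l]_(x in C) V x)
  (\int[p]_(x in C) U x) (\int[q]_(x in C) U x) (\int[l]_(x in C) U x)
  (fine (p C)) (fine (q C)) (fine (l C)) ((em / ep) ^+ 2) =>
  a1 a2 a3 a4 a5 a6 a7 a8 a9 a10.
lra.
Qed.

End antisymmetric_integrals.

(** * Total variation and positivity *)

Lemma tv_norm_le (R : realType) d (T : measurableType d)
    (nu : {charge set T -> \bar R}) (e : R) :
  (forall A, measurable A -> nu A <= e%:E) ->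
  (forall A, measurable A -> - nu A <= e%:E) ->
  tv_norm nu <= (2 * e)%:E.
Proof.
move=> nue Nnue; rewrite /tv_norm.
set hP := cid _; set hN := cid _.
have [[mP _] [mN _] _ _] := svalP hN.
rewrite /charge_variation /= mulr_natl EFin_natmul mule2n leeD//.
  rewrite jordan_posE cjordan_posE /crestr0 mem_set// /crestr setTI.
  exact: nue.
rewrite jordan_negE cjordan_negE /crestr0 mem_set// /crestr setTI.
exact: Nnue.
Qed.

(** Positivity passes from [h] to [f] as soon as [f] vanishes only where [h] does. *)
Lemma integral_gt0 (R : realType) d (T : measurableType d)
    (m : {measure set T -> \bar R}) (D : set T) (f h : T -> \bar R) :
  measurable D -> measurable_fun D f -> measurable_fun D h ->
  (forall x, D x -> 0 <= f x) -> (forall x, D x -> 0 <= h x) ->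
  (forall x, D x -> f x = 0 -> h x = 0) ->
  0 < \int[m]_(x in D) h x -> 0 < \int[m]_(x in D) f x.
Proof.
move=> mD mf mh f0 h0 fh; rewrite !lt_neqAle !integral_ge0// !andbT.
apply: contra => /eqP If0; apply/eqP; rewrite -[LHS](integral0 m D).
apply: ge0_ae_eq_integral => //.
have /(ae_eq_integral_abs m mD mf) : \int[m]_(x in D) `|f x| = 0.
  by rewrite If0; apply: eq_integral => x /[!inE] Dx; rewrite gee0_abs// f0.
by apply: filterS => x /= fx Dx; rewrite fh// fx.
Qed.

(** * Contraction along a trajectory *)

Section contraction.
Context (R : realType) dX (X : measurableType dX) (Y : Type).
Context (Q : R.-pker X ~> X) (C : LD_set_function Y Q).
Local Open Scope ring_scope.

(** The largest product of [rho] over at least [s] of the first [n] transitions,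
    computed by dynamic programming: the first transition is skipped or used. The
    maxima with 0 are there because [rho y y'] may be negative, but only when no point of
    [C y] can reach [C y']; such a transition has probability 0 and may be discarded. *)
Fixpoint contraction (y : nat -> Y) (n s : nat) : R :=
  if n is m.+1 then
    Num.max (contraction (fun k => y k.+1) m s)
      (Num.max 0 (rho C (y 0%N) (y 1%N)) * contraction (fun k => y k.+1) m s.-1)
  else (s == 0)%:R.

Lemma contraction_ge0 y n s : 0 <= contraction y n s.
Proof. by elim: n y s => [|n IH] y s /=; rewrite ?ler0n// le_max IH. Qed.

Lemma contraction_ge1 y n : 1 <= contraction y n 0.
Proof. by elim: n y => [|n IH] y //=; rewrite le_max IH. Qed.

Lemma contraction_attained y n s :
  contraction y n s = 0 \/ exists d : nat -> bool,
    (s <= \sum_(k < n) d k)%N /\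
    contraction y n s = \prod_(k < n) rho C (y k) (y k.+1) ^+ d k.
Proof.
elim: n y s => [|n IH] y s /=.
  case: s => [|s] /=; [right|by left].
  by exists (fun=> false); rewrite !big_ord0.
have [_|_] := leP (contraction (fun k => y k.+1) n s); last first.
  have [->|[d [sd ->]]] := IH (fun k => y k.+1) s; [by left|right].
  exists (fun k => if k is k'.+1 then d k' else false).
  by rewrite !big_ord_recl /= expr0 mul1r add0n.
have [_|_] := leP 0 (rho C (y 0) (y 1)); last by left; rewrite mul0r.
have [->|[d [sd ->]]] := IH (fun k => y k.+1) s.-1; [by left; rewrite mulr0|right].
exists (fun k => if k is k'.+1 then d k' else true).
rewrite !big_ord_recl /= expr1; split => //.
by case: s sd.
Qed.

End contraction.

(** The pairs of points are cut into the blocks D x D, D x N and N x (D u N), where D is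
    the Doeblin set and N its complement; a prime marks the second copy. Only the
    first block benefits from the factor [rho]. *)
Lemma combine_blocks (R : realFieldType)
    (uD uN vD vN uD' uN' vD' vN' pD pN qD qN rho M1 M2 M c : R) :
  (0 <= vD -> 0 <= vN -> 0 <= vD' -> 0 <= vN' -> 0 <= pD -> 0 <= qD ->
  0 <= c -> 0 <= M2 -> rho <= 1 -> M1 <= M -> Num.max 0 rho * M2 <= M ->
  1 = pD + pN -> 1 = qD + qN ->
  uD * vD' <= vD * uD' + rho * (M2 * vD * vD' + c * pD * qD) ->
  uN * (vD' + vN') <= vN * (uD' + uN') + M1 * vN * (vD' + vN') + c * pN * 1 ->
  uD * vN' <= vD * uN' + M1 * vD * vN' + c * pD * qN ->
  (uD + uN) * (vD' + vN') <= (vD + vN) * (uD' + uN')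
    + M * (vD + vN) * (vD' + vN') + c)%R.
Proof.
move=> vD0 vN0 vD'0 vN'0 pD0 qD0 c0 M20 rho1 M1M M2M /eqP.
rewrite addrC -subr_eq => /eqP <- /eqP.
rewrite addrC -subr_eq => /eqP <- DD NT DN.
have Vdd : (0 <= vD * vD')%R by rewrite mulr_ge0.
have rM2 : (rho * M2 <= M)%R.
  by apply: le_trans M2M; rewrite ler_wpM2r// le_max lexx orbT.
have h1 := ler_wpM2r Vdd rM2.
have h2 := ler_wpM2r (mulr_ge0 c0 (mulr_ge0 pD0 qD0)) rho1.
have h3 := ler_wpM2r (mulr_ge0 vN0 (addr_ge0 vD'0 vN'0)) M1M.
have h4 := ler_wpM2r (mulr_ge0 vD0 vN'0) M1M.
lra.
Qed.

(** * Forgetting bound at a finite horizon *)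

Section filter_tail.
Context (R : realType) dX dY (X : measurableType dX) (Y : measurableType dY).
Context (Q : R.-pker X ~> X) (G : R.-pker X ~> Y).
Context (mu : {measure set Y -> \bar R}) (g : transition_density G mu).
Local Open Scope ring_scope.

Definition tail (A : set X) (y : nat -> Y) (n : nat) (x : X) : R :=
  fine (tail_integral Q g (EFin \o \1_A) y n x).

Definition likelihood_bound (y : nat -> Y) (ups : nat -> R) :=
  forall k x, g x (y k) <= ups k.

Let indic_ge0 (A : set X) x : (0 <= (EFin \o \1_A) x :> \bar R)%E.
Proof. by rewrite lee_fin indicE. Qed.

Lemma tail_ge0 A y n x : 0 <= tail A y n x.
Proof. by rewrite fine_ge0// tail_integral_ge0. Qed.

Lemma measurable_tail A y n : measurable A ->
  measurable_fun [set: X] (tail A y n).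
Proof.
move=> mA; apply: measurableT_comp => //.
by apply: measurable_tail_integral => //; apply/measurable_EFinP.
Qed.

Lemma le_tail_integral (A B : set X) y n x : measurable A -> measurable B ->
  A `<=` B ->
  (tail_integral Q g (EFin \o \1_A) y n x <=
   tail_integral Q g (EFin \o \1_B) y n x)%E.
Proof.
move=> mA mB AB.
have mt D z m : measurable D ->
    measurable_fun [set: X] (tail_integral Q g (EFin \o \1_D) z m).
  by move=> mD; apply: measurable_tail_integral => //; exact/measurable_EFinP.
elim: n y x => [|n IH] y x /=.
  rewrite lee_fin !indicE ler_nat.
  by have [/set_mem/AB/mem_set ->|] := boolP (x \in A).
have mg : measurable_fun [set: X] (fun x1 => (g x1 (y 1%N))%:E).
  by apply/measurable_EFinP; exact: measurable_density_l.
apply: ge0_le_integral => //.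
- by move=> x1 _; rewrite mule_ge0 ?lee_fin ?density_ge0// tail_integral_ge0.
- by apply: emeasurable_funM => //; exact: mt.
- by apply: emeasurable_funM => //; exact: mt.
- by move=> x1 _; rewrite lee_wpmul2l ?lee_fin ?density_ge0.
Qed.

Lemma likelihood_bound_ge0 y ups (x : X) k : likelihood_bound y ups -> 0 <= ups k.
Proof. by move=> /(_ k x); apply: le_trans; exact: density_ge0. Qed.

Lemma tail_integral_le A y ups n x : measurable A -> likelihood_bound y ups ->
  (tail_integral Q g (EFin \o \1_A) y n x <= (\prod_(k < n) ups k.+1)%:E)%E.
Proof.
move=> mA; elim: n y ups x => [|n IH] y ups x Hups /=.
  by rewrite big_ord0 lee_fin indicE lern1 leq_b1.
have ups0 k := likelihood_bound_ge0 x k Hups.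
have Hups' : likelihood_bound (fun k => y k.+1) (fun k => ups k.+1).
  by move=> k; exact: (Hups k.+1).
have -> : (\prod_(k < n.+1) ups k.+1)%:E =
    (\int[Q x]_x1 (\prod_(k < n.+1) ups k.+1)%:E)%E.
  by rewrite integral_cst// prob_kernel mule1.
apply: ge0_le_integral => //.
- by move=> x1 _; rewrite mule_ge0 ?lee_fin ?density_ge0// tail_integral_ge0.
- apply: emeasurable_funM.
    by apply/measurable_EFinP; exact: measurable_density_l.
  by apply: measurable_tail_integral => //; exact/measurable_EFinP.
- move=> x1 _; rewrite big_ord_recl EFinM.
  apply: lee_pmul; rewrite ?lee_fin ?density_ge0//.
    exact: tail_integral_ge0.
  exact: IH Hups'.
Qed.

Lemma tail_integralE A y ups n x : measurable A -> likelihood_bound y ups ->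
  tail_integral Q g (EFin \o \1_A) y n x = (tail A y n x)%:E.
Proof.
move=> mA Hups; rewrite fineK// ge0_fin_numE ?tail_integral_ge0//.
by apply: le_lt_trans (tail_integral_le _ _ mA Hups) _; rewrite ltry.
Qed.

Lemma tail_le A y ups n x : measurable A -> likelihood_bound y ups ->
  tail A y n x <= \prod_(k < n) ups k.+1.
Proof.
move=> mA Hups; rewrite -lee_fin -(tail_integralE _ _ mA Hups).
exact: tail_integral_le Hups.
Qed.

Lemma le_tail A B y ups n x : measurable A -> measurable B ->
  likelihood_bound y ups -> A `<=` B -> tail A y n x <= tail B y n x.
Proof.
move=> mA mB Hups AB.
rewrite -lee_fin -(tail_integralE _ _ mA Hups) -(tail_integralE _ _ mB Hups).
exact: le_tail_integral.
Qed.

Lemma tailS A y ups n x : measurable A -> likelihood_bound y ups ->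
  tail A y n.+1 x =
  \int[Q x]_x1 (g x1 (y 1%N) * tail A (fun k => y k.+1) n x1).
Proof.
move=> mA Hups; rewrite /tail /=; congr fine; apply: eq_integral => x1 _.
by rewrite (@tail_integralE _ (fun k => y k.+1) (fun k => ups k.+1))// => k.
Qed.

Lemma integrable_weighted_tail (m : {measure set X -> \bar R}) (D A : set X)
    (y : nat -> Y) (z : Y) (b : R) ups n :
  measurable D -> measurable A -> (m D < +oo)%E ->
  (forall x, g x z <= b) -> likelihood_bound y ups ->
  m.-integrable D (EFin \o (fun x => g x z * tail A y n x)).
Proof.
move=> mD mA mDoo gb Hups.
apply: measurable_bounded_integrable => //.
  apply: measurable_funTS; apply: measurable_funM.
    exact: measurable_density_l.
  exact: measurable_tail.
exists (b * \prod_(k < n) ups k.+1); split; first exact: num_real.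
move=> t bt x Dx /=; apply: le_trans (ltW bt).
rewrite ger0_norm ?mulr_ge0 ?density_ge0 ?tail_ge0//.
by rewrite ler_pM ?density_ge0 ?tail_ge0//; exact: tail_le Hups.
Qed.

Variable C : LD_set_function Y Q.
Variable kappa : R.
Hypothesis kappa0 : 0 <= kappa.
Hypothesis kappa1 : kappa <= 1.

Definition small_off (y : nat -> Y) (ups : nat -> R) :=
  forall k x, ~ C (y k) x -> g x (y k) <= kappa ^+ 2 * ups k.

Definition off (y : Y) (x x' : X) : bool := ~~ ((x \in C y) && (x' \in C y)).

Lemma weight_off y ups k x x' : likelihood_bound y ups -> small_off y ups ->
  g x (y k) * g x' (y k) <= kappa ^+ (2 * off (y k) x x') * ups k ^+ 2.
Proof.
move=> Hups Hoff; rewrite /off negb_and expr2.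
have [Cx|/negP nCx] /= := boolP (x \in C (y k)).
  have [Cx'|/negP nCx'] /= := boolP (x' \in C (y k)).
    by rewrite muln0 expr0 mul1r ler_pM ?density_ge0.
  rewrite muln1 mulrCA ler_pM ?density_ge0//.
  by apply: Hoff => /mem_set.
rewrite muln1 mulrA ler_pM ?density_ge0//.
by apply: Hoff => /mem_set.
Qed.

(** An [off] pair pays a factor [kappa ^+ 2], one [kappa] for each of the two
    transitions that it spoils: this is what lets the exponent of [kappa] grow by
    one at each transition outside the Doeblin sets. *)
Lemma weight_pow_off y ups k x x' (P : R) (e e' : nat) :
  likelihood_bound y ups -> small_off y ups ->
  (e' <= 2 * off (y k) x x' + e)%N ->
  g x (y k) * g x' (y k) * (kappa ^+ e * P ^+ 2) <=
  kappa ^+ e' * (ups k * P) ^+ 2.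
Proof.
move=> Hups Hoff ee'.
apply: le_trans (ler_wpM2r _ (weight_off k x x' Hups Hoff)) _.
  by apply: mulr_ge0; [exact: exprn_ge0|exact: sqr_ge0].
rewrite mulrACA -exprD -exprMn ler_wpM2r ?sqr_ge0//.
exact: ler_wiXn2l.
Qed.

(** The left side exceeds the first term on the right by the integral of
    1_A(x_n) - 1_A(x'_n) over the trajectories from (x, x'). The contraction bounds
    the part with at least [s] good transitions. The others have more than [n - s]
    transitions with an [off] end, each worth a factor [kappa]; the one owed by
    the initial pair, whose own likelihood is not in [tail], is subtracted from the
    exponent. *)
Lemma tail_swap A y ups n s x x' : measurable A ->
  likelihood_bound y ups -> small_off y ups ->
  tail A y n x * tail setT y n x' <=
  tail setT y n x * tail A y n x'
  + contraction C y n s * tail setT y n x * tail setT y n x'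
  + kappa ^+ (n - s - off (y 0%N) x x') * (\prod_(k < n) ups k.+1) ^+ 2.
Proof.
move=> mA.
have mT : measurable [set: X] by [].
(* With threshold 0 the contraction is at least 1 and nothing has to be gained. *)
have swap0 m z b e w w' : likelihood_bound z b ->
    tail A z m w * tail setT z m w' <= tail setT z m w * tail A z m w'
      + contraction C z m 0 * tail setT z m w * tail setT z m w'
      + kappa ^+ e * (\prod_(k < m) b k.+1) ^+ 2.
  move=> Hb; apply: (@le_trans _ _
      (contraction C z m 0 * tail setT z m w * tail setT z m w')).
    rewrite ler_wpM2r ?tail_ge0// (le_trans (le_tail _ _ mA mT Hb _))//.
    by rewrite ler_peMl ?tail_ge0// contraction_ge1.
  rewrite -addrA addrCA lerDl; apply: addr_ge0; apply: mulr_ge0;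
    by rewrite ?sqr_ge0 ?tail_ge0 ?exprn_ge0.
elim: n y ups s x x' => [|n IH] y ups [|s] x x' Hups Hoff.
- exact: swap0.
- rewrite sub0n big_ord0 expr0 /contraction/= !mul0r mul1r addr0.
  rewrite /tail /= !indicE !in_setT expr1n.
  by case: (x \in A); case: (x' \in A) => /=; lra.
- exact: swap0.
pose y' k := y k.+1.
have Hups' : likelihood_bound y' (fun k => ups k.+1) by move=> k; exact: (Hups k.+1).
have Hoff' : small_off y' (fun k => ups k.+1) by move=> k; exact: (Hoff k.+1).
set c := kappa ^+ _ * _.
have c0 : 0 <= c.
  by apply: mulr_ge0; [exact: exprn_ge0|exact: sqr_ge0].
pose U x1 := g x1 (y 1%N) * tail A y' n x1.
pose V x1 := g x1 (y 1%N) * tail setT y' n x1.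
have V0 x1 : 0 <= V x1 by rewrite mulr_ge0 ?density_ge0 ?tail_ge0.
have V0' (m : {measure set X -> \bar R}) D : 0 <= \int[m]_(x1 in D) V x1.
  exact: Rintegral_ge0.
have iU (m : {measure set X -> \bar R}) D : measurable D -> (m D < +oo)%E ->
    m.-integrable D (EFin \o U).
  by move=> mD mDoo; exact: (integrable_weighted_tail n mD mA mDoo (Hups 1%N) Hups').
have iV (m : {measure set X -> \bar R}) D : measurable D -> (m D < +oo)%E ->
    m.-integrable D (EFin \o V).
  by move=> mD mDoo; exact: (integrable_weighted_tail n mD mT mDoo (Hups 1%N) Hups').
(* The induction hypothesis with threshold t, weighted by the likelihoods at time 1. *)
have step t x1 x1' :
    (n.+1 - s.+1 - off (y 0%N) x x' <=
     2 * off (y 1%N) x1 x1' + (n - t - off (y 1%N) x1 x1'))%N ->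
    U x1 * V x1' <= V x1 * U x1' + contraction C y' n t * V x1 * V x1' + c.
  move=> et; have := IH y' _ t x1 x1' Hups' Hoff'.
  move=> /(ler_wpM2l (mulr_ge0 (density_ge0 g x1 (y 1%N))
    (density_ge0 g x1' (y 1%N)))).
  have := weight_pow_off (\prod_(k < n) ups k.+2) Hups Hoff et.
  rewrite (_ : ups 1%N * _ = \prod_(k < n.+1) ups k.+1) -/c; last first.
    by rewrite big_ord_recl.
  rewrite /U /V; lra.
(* If one end of the transition is bad, the threshold stays and kappa is gained. *)
have stepN x1 x1' : off (y 0%N) x x' || off (y 1%N) x1 x1' ->
    U x1 * V x1' <= V x1 * U x1' + contraction C y' n s.+1 * V x1 * V x1' + c.
  move=> o; apply: step; move: o.
  by case: (off _ _ _); case: (off _ _ _) => //= _; lia.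
(* If both ends of the transition are good, it uses up one unit of the threshold. *)
have stepC x1 x1' : C (y 1%N) x1 -> C (y 1%N) x1' ->
    U x1 * V x1' <= V x1 * U x1' + contraction C y' n s * V x1 * V x1' + c.
  move=> Cx1 Cx1'; apply: step.
  have -> : off (y 1%N) x1 x1' = false by rewrite /off !mem_set.
  by rewrite subSS muln0 subn0 leq_subr.
rewrite !(tailS _ _ _ Hups)// -/y' -/(U _) -/(V _).
have QT z : Q z setT = 1%E by exact: prob_kernel.
have Qoo z D : measurable D -> (Q z D < +oo)%E.
  by move=> mD; rewrite (@le_lt_trans _ _ 1%E) ?ltry//
    -(QT z) le_measure ?inE.
have /= [xx'|/negPn/andP[/set_mem Cx /set_mem Cx']] := boolP (off (y 0%N) x x').
  have stepT x1 x1' : [set: X] x1 -> [set: X] x1' ->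
      U x1 * V x1' <= V x1 * U x1' + contraction C y' n s.+1 * V x1 * V x1' + c.
    by move=> _ _; apply: stepN; rewrite xx'.
  have := swap_rectangle mT mT (Qoo x _ mT) (Qoo x' _ mT) (iU _ _ mT (Qoo _ _ mT))
    (iV _ _ mT (Qoo _ _ mT)) (iU _ _ mT (Qoo _ _ mT)) (iV _ _ mT (Qoo _ _ mT)) stepT.
  rewrite !QT /= !mulr1 => /le_trans; apply.
  rewrite lerD2r lerD2l -!mulrA ler_wpM2r ?mulr_ge0 ?Rintegral_ge0//.
  by rewrite le_max lexx.
set D := C (y 1%N) in stepN stepC *.
have mD : measurable D by exact: LD_measurable.
have mN : measurable (~` D) by exact: measurableC.
have DN : D `|` ~` D = setT by rewrite setUv.
have dDN : [disjoint D & ~` D] by apply/disj_setPS; rewrite setICr.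
have split z (f : X -> R) : (Q z).-integrable setT (EFin \o f) ->
    \int[Q z]_x1 f x1 = \int[Q z]_(x1 in D) f x1 + \int[Q z]_(x1 in ~` D) f x1.
  by move=> fi; rewrite -Rintegral_setU// DN.
have split1 z : 1 = fine (Q z D) + fine (Q z (~` D)).
  have := split z (cst 1); rewrite !Rintegral_cst// !QT /= !mul1r; apply.
  apply: measurable_bounded_integrable => //; last exact: bounded_cst.
  exact: Qoo.
set l := LD_lambda C (y 0%N) (y 1%N).
have em0 := LD_em_gt0 C (y 0%N) (y 1%N).
have ep0 := LD_ep_gt0 C (y 0%N) (y 1%N).
(* The minorization of the probability Q x bounds the mass that l gives to D. *)
have lD : (l D < +oo)%E.
  have /andP[+ _] := LD_bounds (y 1%N) Cx measurableT.
  rewrite setTI -/D -/l => /le_lt_trans /(_ (Qoo _ _ mD)).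
  by case: (l D) => [r||//] //; rewrite ?ltry// gt0_muley ?lte_fin.
have DDD := doeblin_swap em0 ep0 (contraction_ge0 C y' n s) c0 mD
  (Qoo _ _ mD) (Qoo _ _ mD) lD (iU _ _ mD (Qoo _ _ mD)) (iV _ _ mD (Qoo _ _ mD))
  (iU _ _ mD (Qoo _ _ mD)) (iV _ _ mD (Qoo _ _ mD))
  (iU _ _ mD lD) (iV _ _ mD lD)
  (fun A mA => LD_bounds (y 1%N) Cx mA) (fun A mA => LD_bounds (y 1%N) Cx' mA)
  (fun x1 _ => V0 x1) stepC.
have stepDN x1 x1' : D x1 -> (~` D) x1' ->
    U x1 * V x1' <= V x1 * U x1' + contraction C y' n s.+1 * V x1 * V x1' + c.
  move=> _ Nx1'; apply: stepN; apply/orP; right.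
  by rewrite /off negb_and (memNset Nx1') orbT.
have stepNT x1 x1' : (~` D) x1 -> [set: X] x1' ->
    U x1 * V x1' <= V x1 * U x1' + contraction C y' n s.+1 * V x1 * V x1' + c.
  move=> Nx1 _; apply: stepN; apply/orP; right.
  by rewrite /off negb_and (memNset Nx1).
have := swap_rectangle mD mN (Qoo x _ mD) (Qoo x' _ mN) (iU _ _ mD (Qoo _ _ mD))
  (iV _ _ mD (Qoo _ _ mD)) (iU _ _ mN (Qoo _ _ mN)) (iV _ _ mN (Qoo _ _ mN)) stepDN.
have := swap_rectangle mN mT (Qoo x _ mN) (Qoo x' _ mT) (iU _ _ mN (Qoo _ _ mN))
  (iV _ _ mN (Qoo _ _ mN)) (iU _ _ mT (Qoo _ _ mT)) (iV _ _ mT (Qoo _ _ mT)) stepNT.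
move: DDD; rewrite !QT /= !(split _ U) ?(split _ V); try exact: iU (Qoo _ _ mT).
move: (split1 x) (split1 x').
have rho1 : rho C (y 0%N) (y 1%N) <= 1 by rewrite gerBl sqr_ge0.
have : Num.max 0 (rho C (y 0%N) (y 1%N)) * contraction C y' n s <=
  contraction C y n.+1 s.+1 by rewrite /= le_max lexx orbT.
have : contraction C y' n s.+1 <= contraction C y n.+1 s.+1.
  by rewrite /= le_max lexx.
- exact: combine_blocks (V0' _ _) (V0' _ _) (V0' _ _) (V0' _ _)
    (fine_ge0 (measure_ge0 _ _)) (fine_ge0 (measure_ge0 _ _)) c0
    (contraction_ge0 C y' n s) rho1.
- exact: iV (Qoo _ _ mT).
- exact: iV (Qoo _ _ mT).
Qed.

Lemma weighted_tail_swap A y ups n s x x' : measurable A ->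
  likelihood_bound y ups -> small_off y ups ->
  (g x (y 0%N) * tail A y n x) *
  (g x' (y 0%N) * tail setT y n x') <=
  (g x (y 0%N) * tail setT y n x) *
  (g x' (y 0%N) * tail A y n x')
  + contraction C y n s * (g x (y 0%N) * tail setT y n x) *
    (g x' (y 0%N) * tail setT y n x')
  + kappa ^+ (n - s) * (\prod_(k < n.+1) ups k) ^+ 2.
Proof.
move=> mA Hups Hoff; have := tail_swap n s x x' mA Hups Hoff.
move=> /(ler_wpM2l (mulr_ge0 (density_ge0 g x (y 0%N))
    (density_ge0 g x' (y 0%N)))).
have et : (n - s <= 2 * off (y 0%N) x x' + (n - s - off (y 0%N) x x'))%N.
  by case: off => /=; lia.
have := weight_pow_off (\prod_(k < n) ups k.+1) Hups Hoff et.
rewrite (_ : ups 0%N * _ = \prod_(k < n.+1) ups k); last by rewrite big_ord_recl.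
lra.
Qed.

Definition mass (nu : probability X R) (y : nat -> Y) (n : nat) (A : set X) : R :=
  \int[nu]_x (g x (y 0%N) * tail A y n x).

Lemma integrable_mass (nu : probability X R) A y ups n : measurable A ->
  likelihood_bound y ups ->
  nu.-integrable setT (EFin \o (fun x => g x (y 0%N) * tail A y n x)).
Proof.
move=> mA Hups.
have nuoo : (nu setT < +oo)%E by rewrite probability_setT ltry.
exact: (integrable_weighted_tail n measurableT mA nuoo (Hups 0%N) Hups).
Qed.

Lemma unnormalized_filterE (nu : probability X R) A y ups n : measurable A ->
  likelihood_bound y ups ->
  unnormalized_filter Q g nu y n A = (mass nu y n A)%:E.
Proof.
move=> mA Hups; rewrite fineK; last first.
  by apply: integrable_fin_num => //; exact: integrable_mass Hups.
by apply: eq_integral => x _; rewrite (tail_integralE _ _ mA Hups).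
Qed.

Lemma filteringE (nu : probability X R) A y ups n : measurable A ->
  likelihood_bound y ups -> 0 < mass nu y n setT ->
  filtering Q g nu y n A = (mass nu y n A / mass nu y n setT)%:E.
Proof.
move=> mA Hups m0; rewrite /filtering /mnormalize /=.
rewrite (unnormalized_filterE _ _ measurableT Hups)// eqe gt_eqF//=.
by rewrite (unnormalized_filterE _ _ mA Hups) EFinM.
Qed.

Lemma mass_swap (nu nu' : probability X R) A y ups n s : measurable A ->
  likelihood_bound y ups -> small_off y ups ->
  mass nu y n A * mass nu' y n setT <=
  mass nu y n setT * mass nu' y n A
  + contraction C y n s * mass nu y n setT * mass nu' y n setT
  + kappa ^+ (n - s) * (\prod_(k < n.+1) ups k) ^+ 2.
Proof.
move=> mA Hups Hoff.
have nuoo (m : probability X R) : (m setT < +oo)%E.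
  by rewrite probability_setT ltry.
have im m D : measurable D -> _ := fun mD => integrable_mass m n mD Hups.
have := swap_rectangle measurableT measurableT (nuoo nu) (nuoo nu')
  (im nu A mA) (im nu setT measurableT) (im nu' A mA) (im nu' setT measurableT)
  (fun x x' _ _ => weighted_tail_swap n s x x' mA Hups Hoff).
have nuT (m : probability X R) : (m : {measure set X -> \bar R}) setT = 1%E.
  exact: probability_setT.
by rewrite !nuT /= !mulr1.
Qed.

Lemma filtering_gap (nu nu' : probability X R) A y ups n s : measurable A ->
  likelihood_bound y ups -> small_off y ups ->
  0 < mass nu y n setT -> 0 < mass nu' y n setT ->
  (filtering_diff Q g nu nu' y n A <=
   (contraction C y n s + kappa ^+ (n - s) * (\prod_(k < n.+1) ups k) ^+ 2
      / (mass nu y n setT * mass nu' y n setT))%:E)%E.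
Proof.
move=> mA Hups Hoff m0 m0'.
change (filtering Q g nu y n A - filtering Q g nu' y n A <=
   (contraction C y n s + kappa ^+ (n - s) * (\prod_(k < n.+1) ups k) ^+ 2
      / (mass nu y n setT * mass nu' y n setT))%:E)%E.
rewrite !(filteringE _ Hups)// -EFinB lee_fin.
have mm : 0 < mass nu y n setT * mass nu' y n setT by rewrite mulr_gt0.
have -> : mass nu y n A / mass nu y n setT - mass nu' y n A / mass nu' y n setT
    = (mass nu y n A * mass nu' y n setT - mass nu y n setT * mass nu' y n A)
      / (mass nu y n setT * mass nu' y n setT).
  by field; rewrite !gt_eqF.
rewrite ler_pdivrMr// mulrDl mulfVK ?gt_eqF//.
have := mass_swap nu nu' n s mA Hups Hoff; lra.
Qed.

Lemma filtering_diffN (nu nu' : probability X R) A y n : measurable A ->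
  (- filtering_diff Q g nu nu' y n A = filtering_diff Q g nu' nu y n A)%E.
Proof.
move=> mA.
change (- (filtering Q g nu y n A - filtering Q g nu' y n A) =
  filtering Q g nu' y n A - filtering Q g nu y n A)%E.
by rewrite fin_num_oppeB ?fin_num_measure// addeC.
Qed.

Lemma tv_filtering_le (nu nu' : probability X R) y ups n s :
  likelihood_bound y ups -> small_off y ups ->
  0 < mass nu y n setT -> 0 < mass nu' y n setT ->
  (tv_norm (filtering_diff Q g nu nu' y n) <=
   (2 * (contraction C y n s + kappa ^+ (n - s) * (\prod_(k < n.+1) ups k) ^+ 2
      / (mass nu y n setT * mass nu' y n setT)))%:E)%E.
Proof.
move=> Hups Hoff m0 m0'; apply: tv_norm_le => A mA; first exact: filtering_gap.
by rewrite filtering_diffN// [mass nu _ _ _ * _]mulrC; exact: filtering_gap.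
Qed.

End filter_tail.

(** * Lower bound on the normalizing mass *)

Section mass_lower_bound.
Context (R : realType) dX dY (X : measurableType dX) (Y : measurableType dY).
Context (Q : R.-pker X ~> X) (G : R.-pker X ~> Y).
Context (mu : {measure set Y -> \bar R}) (g : transition_density G mu).
Hypothesis g_gt0 : forall x y, (0 < g x y)%R.
Variable C : LD_set_function Y Q.

Let indic_ge0 (A : set X) x : 0 <= (EFin \o \1_A) x :> \bar R.
Proof. by rewrite lee_fin indicE. Qed.

Let measurable_tailT y n :
  measurable_fun [set: X] (tail_integral Q g (EFin \o \1_setT) y n).
Proof.
by apply: measurable_tail_integral => //; apply/measurable_EFinP.
Qed.

Let measurable_g y (D : set X) : measurable_fun D (fun x => (g x y)%:E).
Proof.
by apply/measurable_funTS/measurable_EFinP; exact: measurable_density_l.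
Qed.

Lemma step_lower_bound (m : {measure set X -> \bar R}) (z : Y) (y : nat -> Y) n
    (p : R) (D : set X) :
  measurable D -> (0 <= p)%R ->
  (forall x, D x -> p%:E <= tail_integral Q g (EFin \o \1_setT) y n x) ->
  p%:E * \int[m]_(x in D) (g x z)%:E <=
  \int[m]_x ((g x z)%:E * tail_integral Q g (EFin \o \1_setT) y n x).
Proof.
move=> mD p0 pt; rewrite -ge0_integralZl_EFin//; last first.
  by move=> x _; rewrite lee_fin density_ge0.
apply: (@le_trans _ _ (\int[m]_(x in D)
    ((g x z)%:E * tail_integral Q g (EFin \o \1_setT) y n x))).
  apply: ge0_le_integral => //.
  - by move=> x _; rewrite mule_ge0 ?lee_fin ?density_ge0.
  - exact: measurable_funeM.
  - by apply: emeasurable_funM => //; exact: measurable_funTS.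
  - by move=> x Dx; rewrite muleC lee_wpmul2l ?lee_fin ?density_ge0// pt.
apply: ge0_subset_integral => //; first exact: emeasurable_funM.
by move=> x _; rewrite mule_ge0 ?lee_fin ?density_ge0 ?tail_integral_ge0.
Qed.

(** Forcing the chain to visit [C (y k)] at every time [k] costs, at each step, the
    lower Doeblin bound for the integral of the likelihood over [C (y k.+1)]. *)
Lemma tail_lower_bound (y : nat -> Y) (psi : nat -> R) n x :
  (forall k, (0 <= psi k)%R) ->
  (forall k, (psi k)%:E <= Psi g C (y k) (y k.+1)) -> C (y 0%N) x ->
  (\prod_(k < n) (LD_em C (y k) (y k.+1) * psi k)%R)%:E <=
  tail_integral Q g (EFin \o \1_setT) y n x.
Proof.
move=> psi0 psiC; elim: n y psi x psi0 psiC => [|n IH] y psi x psi0 psiC Cx /=.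
  by rewrite big_ord0 indicE in_setT.
rewrite big_ord_recl EFinM /=.
set p := (\prod_(i < n) _)%R.
have p0 : (0 <= p)%R.
  by apply: prodr_ge0 => i _; rewrite mulr_ge0// ltW// LD_em_gt0.
have mC : measurable (C (y 1%N)) by exact: LD_measurable.
apply: le_trans (step_lower_bound (Q x) (y 1%N) mC p0
  (fun x1 Cx1 => IH (fun k => y k.+1) (fun k => psi k.+1) x1
    (fun k => psi0 k.+1) (fun k => psiC k.+1) Cx1)).
rewrite muleC lee_wpmul2l ?lee_fin// EFinM.
apply: (@le_trans _ _ ((LD_em C (y 0%N) (y 1%N))%:E * Psi g C (y 0%N) (y 1%N))).
  by rewrite lee_wpmul2l ?lee_fin ?(ltW (LD_em_gt0 _ _ _)).
rewrite -[leRHS]mul1e.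
apply: le_scale_measure_integral_on => //.
- exact/ltW/LD_em_gt0.
- by move=> A mA; rewrite mul1e; have /andP[] := LD_bounds (y 1%N) Cx mA.
- by move=> x1 _; rewrite lee_fin density_ge0.
Qed.

Let measurable_kernel_integral_g (z : Y) (D : set X) : measurable D ->
  measurable_fun [set: X] (fun x => \int[Q x]_(x1 in D) (g x1 z)%:E).
Proof.
move=> mD; under eq_fun do rewrite integral_mkcond.
apply: (measurable_fun_integral_finite_kernel
  (fun p : X * X => ((fun x1 => (g x1 z)%:E) \_ D) p.2) Q).
  by move=> p; rewrite patchE; case: ifP => // _; rewrite lee_fin density_ge0.
apply: (measurableT_comp _ measurable_snd).
exact/(measurable_restrictT _ _).1.
Qed.

Lemma initial_mass_gt0 (nu : probability X R) (y0 y1 : Y) :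
  0 < \int[nu]_x Q x (C y1) ->
  0 < \int[nu]_x ((g x y0)%:E * \int[Q x]_(x1 in C y1) (g x1 y1)%:E).
Proof.
have mC : measurable (C y1) by exact: LD_measurable.
have Ig0 x : 0 <= \int[Q x]_(x1 in C y1) (g x1 y1)%:E.
  by apply: integral_ge0 => x1 _; rewrite lee_fin density_ge0.
apply: integral_gt0 => //.
- apply: emeasurable_funM => //.
  exact: measurable_kernel_integral_g.
- exact: measurable_kernel.
- by move=> x _; rewrite mule_ge0// lee_fin density_ge0.
- move=> x _ /eqP; rewrite mule_eq0 eqe gt_eqF//= => /eqP I0.
  apply/eqP; rewrite eq_le measure_ge0 andbT leNgt; apply/negP => Q0.
  suff : 0 < \int[Q x]_(x1 in C y1) (g x1 y1)%:E by rewrite I0 ltxx.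
  apply: (@integral_gt0 _ _ _ _ _ _ (cst 1)) => //.
  - by move=> x1 _; rewrite lee_fin density_ge0.
  - by move=> x1 _ /eqP; rewrite eqe gt_eqF.
  - by rewrite integral_cst// mul1e.
Qed.

(** The constant [c] is the mass of the first two steps; the initial point need not
    lie in a Doeblin set, so the Doeblin bounds start at time 1. *)
Lemma mass_lower_bound (nu : probability X R) (y : nat -> Y) (ups psi : nat -> R) :
  likelihood_bound g y ups ->
  (forall k, (0 <= psi k)%R) ->
  (forall k, (psi k)%:E <= Psi g C (y k.+1) (y k.+2)) ->
  0 < \int[nu]_x Q x (C (y 1%N)) ->
  exists2 c : R, (0 < c)%R & forall n,
    (c * \prod_(k < n) (LD_em C (y k.+1) (y k.+2) * psi k) <=
      mass Q g nu y n.+1 setT)%R.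
Proof.
move=> Hups psi0 psiC nuQ.
have := initial_mass_gt0 (y 0%N) nuQ.
set c0 := integral _ _ _ => c00.
(* Any positive real below c0 would do; 1 serves when c0 is infinite. *)
exists (if c0 == +oo then 1%R else fine c0).
  by case: ifPn => // c0oo; apply: fine_gt0; rewrite c00 ltey.
move=> n; rewrite -lee_fin -(unnormalized_filterE _ _ _ measurableT Hups).
set p := (\prod_(k < n) _)%R.
have p0 : (0 <= p)%R.
  by apply: prodr_ge0 => i _; rewrite mulr_ge0// ltW// LD_em_gt0.
apply: (@le_trans _ _ (p%:E * c0)).
  rewrite mulrC EFinM lee_wpmul2l ?lee_fin//.
  by case: ifPn => [/eqP->|c0oo]; rewrite ?leey// fineK// gt0_fin_numE// ltey.
rewrite /c0 -ge0_integralZl_EFin//; last 2 first.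
- move=> x _; rewrite mule_ge0 ?lee_fin ?density_ge0//.
  by apply: integral_ge0 => x1 _; rewrite lee_fin density_ge0.
- apply: emeasurable_funM; first exact: measurable_g.
  by apply: measurable_kernel_integral_g; exact: LD_measurable.
apply: ge0_le_integral => //.
- move=> x _; rewrite mule_ge0 ?lee_fin// mule_ge0 ?lee_fin ?density_ge0//.
  by apply: integral_ge0 => x1 _; rewrite lee_fin density_ge0.
- apply: measurable_funeM; apply: emeasurable_funM; first exact: measurable_g.
  by apply: measurable_kernel_integral_g; exact: LD_measurable.
- by apply: emeasurable_funM; [exact: measurable_g|exact: measurable_tailT].
- move=> x _; rewrite muleCA lee_wpmul2l ?lee_fin ?density_ge0//.
  apply: (step_lower_bound (Q x) (y 1%N) (LD_measurable C (y 1%N)) p0) => x1 Cx1.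
  exact: (tail_lower_bound (y := fun k => y k.+1)).
Qed.

End mass_lower_bound.

(** * Upper and lower limits of averages *)

Section limits.
Context (R : realType).
Implicit Types (u : nat -> \bar R) (a : \bar R).

Lemma near_lt_limn_esup u a : limn_esup u < a -> \forall n \near \oo, u n < a.
Proof.
rewrite /limn_esup limf_esupE => /ereal_inf_lt[_ [V FV <-]] Va.
apply: filterS FV => n Vn; apply: le_lt_trans Va.
by apply: ereal_sup_ubound; exists n.
Qed.

Lemma near_gt_limn_einf u a : a < limn_einf u -> \forall n \near \oo, a < u n.
Proof.
rewrite /limn_einf lteNr => /near_lt_limn_esup.
by apply: filterS => n; rewrite lteN2.
Qed.

Lemma limn_esup_le_near u a : (\forall n \near \oo, u n <= a) -> limn_esup u <= a.
Proof.
move=> ua; rewrite /limn_esup limf_esupE.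
apply: (@le_trans _ _ (ereal_sup (u @` [set n | u n <= a]))).
  by apply: ereal_inf_lbound; exists [set n | u n <= a].
by apply: ge_ereal_sup => _ [n /= una <-].
Qed.

Lemma limn_esup_lt0 u : limn_esup u < 0 ->
  exists2 c : R, (0 < c)%R & \forall n \near \oo, u n < (- c)%:E.
Proof.
move=> u0; have [c c0 uc] : exists2 c : R, (0 < c)%R & limn_esup u < (- c)%:E.
  case: (limn_esup u) u0 => [r| |] //=; last by exists 1%R; rewrite ?ltNyr.
  rewrite lte_fin => r0; exists (- r / 2)%R; first by rewrite divr_gt0// oppr_gt0.
  by rewrite lte_fin; lra.
by exists c => //; exact: near_lt_limn_esup.
Qed.

Lemma near_le_scale (a b : R) : (0 < a)%R ->
  \forall n \near \oo, (b <= a * n%:R)%R.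
Proof.
move=> a0; apply: filterS (nbhs_infty_ger (b / a)%R) => n.
by rewrite ler_pdivrMr// mulrC.
Qed.

Lemma lne_leE (x : \bar R) (t : R) : (lne x <= t%:E) = (x <= (expR t)%:E).
Proof.
case: x => [r| |] //=; rewrite ?leNye// lee_fin.
have [r0|r0] := leP r 0%R; first by rewrite leNye (le_trans r0)// expR_ge0.
by rewrite lee_fin -ler_expR lnK.
Qed.

(** One infinite term would make all later averages infinite, so a finite upper limit
    forces all terms to be finite. *)
Lemma limn_esup_mean_lt (v : nat -> \bar R) (M : R) :
  (forall k, v k != -oo) ->
  limn_esup (fun n => (n%:R^-1)%:E * \sum_(0 <= k < n.+1) v k) < M%:E ->
  (forall k, v k \is a fin_num) /\
  \forall n \near \oo, (\sum_(k < n.+1) fine (v k) <= M * n%:R)%R.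
Proof.
move=> vNy /near_lt_limn_esup vM.
have nM : \forall n \near \oo, \sum_(k < n.+1) v k < (M * n%:R)%:E.
  near=> n; have n0 : (0 < n%:R :> R)%R.
    by rewrite ltr0n; near: n; exact: nbhs_infty_gt.
  rewrite -(big_mkord xpredT v) mulrC EFinM -lte_pdivrMl//.
  by near: n.
have vfin k : v k \is a fin_num.
  rewrite fin_numE vNy /=; apply/negP => /eqP vk.
  have [n [kn]] : exists n, (k < n)%N /\ \sum_(k < n.+1) v k < (M * n%:R)%:E.
    near \oo => n; exists n; split; first by near: n; exact: nbhs_infty_gt.
    by near: n.
  suff -> : \sum_(k < n.+1) v k = +oo by [].
  apply/esum_eqyP => //; exists (Ordinal (leqW kn)); split => //.
split => //; apply: filterS nM => n.
by rewrite -lee_fin -sumEFin => /ltW; congr (_ <= _); apply: eq_bigr => k _;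
  rewrite fineK.
Unshelve. all: by end_near. Qed.

(** A term equal to -oo absorbs all others in a sum of extended reals, +oo
    included. *)
Lemma limn_einf_mean_gt (v : nat -> \bar R) (M : R) :
  (- M)%:E < limn_einf (fun n => (n%:R^-1)%:E * \sum_(2 <= k < n.+1) v k) ->
  (forall k, v k.+2 != -oo) /\
  \forall n \near \oo, (- M * n%:R)%:E <= \sum_(k < n.-1) v k.+2.
Proof.
move=> /near_gt_limn_einf vM.
have nM : \forall n \near \oo, (- M * n%:R)%:E < \sum_(k < n.-1) v k.+2.
  near=> n; have n0 : (0 < n)%N by near: n; exact: nbhs_infty_gt.
  have n0' : (0 < n%:R :> R)%R by rewrite ltr0n.
  rewrite mulrC EFinM -lte_pdivlMl//.
  have -> : \sum_(k < n.-1) v k.+2 = \sum_(2 <= k < n.+1) v k.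
    rewrite -(big_mkord xpredT (fun k => v k.+2)) -[2%N]add0n big_addn.
    by rewrite (_ : (n.+1 - 2)%N = n.-1); [apply: eq_bigr => k _; rewrite addn2|lia].
  by near: n.
split; last by apply: filterS nM => n /ltW.
move=> k; apply/negP => /eqP vk.
have [n [kn]] : exists n, (k.+2 < n)%N /\
    (- M * n%:R)%:E < \sum_(k < n.-1) v k.+2.
  near \oo => n; exists n; split; first by near: n; exact: nbhs_infty_gt.
  by near: n.
suff -> : \sum_(k < n.-1) v k.+2 = -oo by [].
have kn1 : (k < n.-1)%N by lia.
apply/esum_eqNyP; exists (Ordinal kn1); split => //.
Unshelve. all: by end_near. Qed.

(** At least (n - 1)/2 factors kappa remain, which gives exp(-(6 M + 4)(n - 1)), while
    the other factors are at most exp((6 M + 2) n). The product is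
    exp(-2 n + 6 M + 4). *)
Lemma rare_visits_rate (M u m m' : R) (n : nat) : (0 < M)%R ->
  (0 <= u)%R -> (u <= expR (M * n%:R))%R ->
  (expR (- (2 * M + 1) * n%:R) <= m)%R -> (expR (- (2 * M + 1) * n%:R) <= m')%R ->
  (6 * M + 4 <= n%:R)%R ->
  (expR (- (12 * M + 8)) ^+ (n - uphalf n) * u ^+ 2 / (m * m') <= expR (- n%:R))%R.
Proof.
move=> M0 u0 un mn mn' Kn.
have hn : (n <= 2 * (n - uphalf n) + 1)%N by lia.
have hn' : (n%:R <= 2 * (n - uphalf n)%:R + 1 :> R)%R.
  by rewrite -natrM natr1 -addn1 ler_nat.
have kn : (expR (- (12 * M + 8)) ^+ (n - uphalf n)
    <= expR ((12 * M + 8) * (1 - n%:R) / 2))%R.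
  rewrite -expRM_natr ler_expR.
  have K0 : (0 <= 12 * M + 8)%R by lra.
  move: (_%:R) hn' => e /(ler_wpM2l K0); lra.
have un2 : (u ^+ 2 <= expR (2 * M * n%:R))%R.
  by rewrite -mulrA [(2 * _)%R]mulrC expRM_natr lerXn2r ?nnegrE ?expR_ge0.
have mm : ((m * m')^-1 <= expR (2 * (2 * M + 1) * n%:R))%R.
  have m0 := lt_le_trans (expR_gt0 _) mn.
  have m0' := lt_le_trans (expR_gt0 _) mn'.
  rewrite -[leRHS]invrK lef_pV2 ?posrE ?mulr_gt0 ?invr_gt0 ?expR_gt0//.
  rewrite -expRN.
  have -> : (- (2 * (2 * M + 1) * n%:R) =
    - (2 * M + 1) * n%:R + - (2 * M + 1) * n%:R)%R by ring.
  by rewrite expRD ler_pM ?expR_ge0.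
have m0 : (0 <= m)%R by apply: le_trans mn; exact: expR_ge0.
have m0' : (0 <= m')%R by apply: le_trans mn'; exact: expR_ge0.
apply: le_trans (ler_pM _ _ (ler_pM _ _ kn un2) mm) _.
- by apply: mulr_ge0; rewrite ?sqr_ge0// exprn_ge0// expR_ge0.
- by rewrite invr_ge0 mulr_ge0.
- by rewrite exprn_ge0// expR_ge0.
- exact: sqr_ge0.
rewrite -!expRD ler_expR; lra.
Qed.

End limits.

(** * Exponential rates along a trajectory *)

Section exponential_rates.
Context (R : realType) dX dY (X : measurableType dX) (Y : measurableType dY).
Context (Q : R.-pker X ~> X) (G : R.-pker X ~> Y).
Context (mu : {measure set Y -> \bar R}) (g : transition_density G mu).
Hypothesis g_gt0 : forall x y, (0 < g x y)%R.
Variables (y : nat -> Y) (M : R).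

Lemma Upsilon_growth (x0 : X) :
  limn_esup (fun n : nat => (n%:R^-1)%:E *
    \sum_(0 <= k < n.+1) lne (Upsilon g [set: X] (y k))) < M%:E ->
  exists ups : nat -> R, [/\ likelihood_bound g y ups,
    forall k, Upsilon g [set: X] (y k) = (ups k)%:E &
    \forall n \near \oo, (\prod_(k < n.+1) ups k <= expR (M * n%:R))%R].
Proof.
have gU x k : (g x (y k))%:E <= Upsilon g [set: X] (y k).
  by apply: ereal_sup_ubound; exists x.
have U0 k : 0 < Upsilon g [set: X] (y k).
  by apply: lt_le_trans (gU x0 k); rewrite lte_fin.
move=> /(limn_esup_mean_lt (v := fun k => lne (Upsilon g [set: X] (y k))))
  [|vfin vM].
  move=> k; move: (U0 k); case: (Upsilon _ _ _) => //= r.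
  by rewrite lte_fin ltNge => /negbTE ->.
have Ufin k : Upsilon g [set: X] (y k) = (fine (Upsilon g [set: X] (y k)))%:E.
  by move: (vfin k) (U0 k); case: (Upsilon _ _ _).
exists (fun k => fine (Upsilon g [set: X] (y k))); split => //.
  by move=> k x; rewrite -lee_fin -Ufin.
apply: filterS vM => n vn; rewrite -ler_expR expR_sum in vn.
move: vn; congr (_ <= _)%R.
apply: eq_bigr => k _; have := U0 k; rewrite Ufin lte_fin => u0.
by rewrite lne_EFin//= lnK.
Qed.

Variable C : LD_set_function Y Q.

(** The averages of log Psi already force every C(y_k) to be nonempty; the Doeblin
    bound from one of its points then makes lambda, hence Psi, finite. *)
Lemma Psi_growth (ups : nat -> R) : likelihood_bound g y ups ->
  (exists x, C (y 1%N) x) ->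
  (- M)%:E < limn_einf (fun n : nat => (n%:R^-1)%:E *
    \sum_(2 <= k < n.+1) lne (Psi g C (y k.-1) (y k))) ->
  exists psi : nat -> R, [/\ forall k, (0 < psi k)%R,
    forall k, Psi g C (y k.+1) (y k.+2) = (psi k)%:E &
    \forall n \near \oo, (expR (- M * n%:R) <= \prod_(k < n.-1) psi k)%R].
Proof.
move=> Hups C1 /(limn_einf_mean_gt (v := fun k => lne (Psi g C (y k.-1) (y k)))) /=.
move=> [vNy vM].
have P0 k : 0 < Psi g C (y k.+1) (y k.+2).
  by rewrite ltNge; apply/negP => /le0_lneNy /eqP; apply/negP; exact: vNy.
have Cne k : exists x, C (y k.+1) x.
  case: k => [//|k]; apply/not_existsP => C0.
  have := P0 k; rewrite /Psi (_ : C (y k.+2) = set0) ?integral_set0 ?ltxx//.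
  by apply/seteqP; split => x // /C0.
have Pfin k : Psi g C (y k.+1) (y k.+2) = (fine (Psi g C (y k.+1) (y k.+2)))%:E.
  rewrite fineK// gt0_fin_numE//.
  have [x Cx] := Cne k.
  have mC := LD_measurable C (y k.+2).
  have loo : LD_lambda C (y k.+1) (y k.+2) (C (y k.+2)) < +oo.
    have Qoo : Q x (C (y k.+2)) < +oo.
      have QT : Q x setT = 1 by exact: prob_kernel.
      by rewrite (@le_lt_trans _ _ 1)// ?ltry// -QT le_measure ?inE.
    have /andP[+ _] := LD_bounds (y k.+2) Cx measurableT.
    rewrite setTI => /le_lt_trans /(_ Qoo).
    case: (LD_lambda _ _ _ _) => [r||] //; rewrite ?ltry//.
    by rewrite gt0_muley ?lte_fin ?LD_em_gt0.
  apply: (@le_lt_trans _ _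
      ((ups k.+2)%:E * LD_lambda C (y k.+1) (y k.+2) (C (y k.+2)))).
    rewrite -integral_cst//; apply: ge0_le_integral => //.
    - by move=> x1 _; rewrite lee_fin density_ge0.
    - by apply/measurable_funTS/measurable_EFinP; exact: measurable_density_l.
    - by move=> x1 _; rewrite lee_fin.
  rewrite lte_mul_pinfty// ?lee_fin//.
  exact: likelihood_bound_ge0 x _ Hups.
exists (fun k => fine (Psi g C (y k.+1) (y k.+2))); split => //.
  by move=> k; rewrite -lte_fin -Pfin.
apply: filterS vM => n.
have -> : \sum_(k < n.-1) lne (Psi g C (y k.+1) (y k.+2)) =
    (\sum_(k < n.-1) ln (fine (Psi g C (y k.+1) (y k.+2))))%:E.
  rewrite -sumEFin; apply: eq_bigr => k _; rewrite {1}Pfin lne_EFin//.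
  by rewrite -lte_fin -Pfin.
move=> vn; rewrite lee_fin -ler_expR expR_sum in vn.
move: vn; congr (_ <= _)%R.
apply: eq_bigr => k _.
by rewrite lnK// posrE -lte_fin -Pfin.
Qed.

Lemma LD_em_growth :
  (- M)%:E < limn_einf (fun n : nat => (n%:R^-1)%:E *
    \sum_(2 <= k < n.+1) (ln (LD_em C (y k.-1) (y k)))%:E) ->
  \forall n \near \oo,
    (expR (- M * n%:R) <= \prod_(k < n.-1) LD_em C (y k.+1) (y k.+2))%R.
Proof.
move=> /(limn_einf_mean_gt (v := fun k => (ln (LD_em C (y k.-1) (y k)))%:E)) [_].
apply: filterS => n vn; rewrite sumEFin lee_fin -ler_expR expR_sum in vn.
move: vn; congr (_ <= _)%R; apply: eq_bigr => k _.
by rewrite lnK// posrE LD_em_gt0.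
Qed.

Lemma mass_growth (nu : probability X R) (ups psi : nat -> R) :
  likelihood_bound g y ups ->
  (forall k, (0 < psi k)%R) ->
  (forall k, Psi g C (y k.+1) (y k.+2) = (psi k)%:E) ->
  (\forall n \near \oo, (expR (- M * n%:R) <= \prod_(k < n.-1) psi k)%R) ->
  (\forall n \near \oo,
    (expR (- M * n%:R) <= \prod_(k < n.-1) LD_em C (y k.+1) (y k.+2))%R) ->
  0 < \int[nu]_x Q x (C (y 1%N)) ->
  \forall n \near \oo,
    (expR (- (2 * M + 1) * n%:R) <= mass Q g nu y n setT)%R.
Proof.
move=> Hups psi0 psiC psiM emM nuQ.
have psiC' k : (psi k)%:E <= Psi g C (y k.+1) (y k.+2) by rewrite psiC.
have [c c0 cm] := mass_lower_bound g_gt0 Hups (fun k => ltW (psi0 k)) psiC' nuQ.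
near=> n.
have n0 : (0 < n)%N by near: n; exact: nbhs_infty_gt.
have := cm n.-1; rewrite prednK// big_split /=; apply: le_trans.
have -> : (- (2 * M + 1) * n%:R = - n%:R + (- M * n%:R + - M * n%:R))%R by ring.
rewrite !expRD; apply: ler_pM; rewrite ?mulr_ge0 ?expR_ge0//.
  rewrite -[leRHS]lnK ?posrE// ler_expR lerNl.
  have : (- ln c <= 1 * n%:R)%R by near: n; exact: near_le_scale.
  by rewrite mul1r.
by apply: ler_pM; rewrite ?expR_ge0//; near: n.
Unshelve. all: by end_near. Qed.

End exponential_rates.

Section forgetting.
Context (R : realType) dX dY (X : measurableType dX) (Y : measurableType dY).
Context (Q : R.-pker X ~> X) (G : R.-pker X ~> Y).
Context (mu : {measure set Y -> \bar R}) (g : transition_density G mu).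
Hypothesis g_gt0 : forall x y, (0 < g x y)%R.

Lemma small_off_Upsilon (D : LD_set_function Y Q) (kappa : R) y ups :
  (forall z, Upsilon g (~` D z) z <= (kappa ^+ 2)%:E * Upsilon g [set: X] z) ->
  (forall k, Upsilon g [set: X] (y k) = (ups k)%:E) ->
  small_off g D kappa y ups.
Proof.
move=> DU Uups k x nDx; rewrite -lee_fin EFinM -Uups.
apply: le_trans (DU (y k)).
by apply: ereal_sup_ubound; exists x.
Qed.

Lemma contraction_le_Lambda (D : LD_set_function Y Q) (y : nat -> Y) n (e : R) :
  (0 <= e)%R -> Lambda D y n (2^-1 : R) <= e%:E ->
  (contraction D y n (uphalf n) <= e)%R.
Proof.
move=> e0 Le; have [->//|[d [sd ->]]] := contraction_attained D y n (uphalf n).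
rewrite -lee_fin; apply: le_trans Le.
pose delta : {ffun 'I_n -> bool} := [ffun k : 'I_n => d k].
have -> : (\prod_(k < n) rho D (y k) (y k.+1) ^+ d k)%R =
    (\prod_(k < n) rho D (y k) (y k.+1) ^+ delta k)%R.
  by apply: eq_bigr => k _; rewrite ffunE.
apply: (le_bigmax_cond -oo
  (fun delta : {ffun 'I_n -> bool} =>
    (\prod_(k < n) rho D (y k) (y k.+1) ^+ delta k)%R%:E)).
rewrite ler_pdivrMl// -natrM ler_nat.
rewrite (eq_bigr (fun k : 'I_n => d k : nat)); last by move=> k _; rewrite ffunE.
by move: sd; set s := bigop _ _ _; lia.
Qed.

(** Forgetting holds on each trajectory separately. [D] is the Doeblin set function of
    level eta = exp(-(12 M + 8))^2, whose square root is the [kappa] of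
    [rare_visits_rate]. *)
Lemma filter_forgetting (D C : LD_set_function Y Q) (M : R) (y : nat -> Y)
    (nu nu' : probability X R) :
  (forall z, Upsilon g (~` D z) z <=
     (expR (- (12 * M + 8)) ^+ 2)%:E * Upsilon g [set: X] z) ->
  (0 < M)%R ->
  (- M)%:E < limn_einf (fun n : nat => (n%:R^-1)%:E *
    \sum_(2 <= k < n.+1) (ln (LD_em C (y k.-1) (y k)))%:E) ->
  limn_esup (fun n : nat => (n%:R^-1)%:E *
    \sum_(0 <= k < n.+1) lne (Upsilon g [set: X] (y k))) < M%:E ->
  (- M)%:E < limn_einf (fun n : nat => (n%:R^-1)%:E *
    \sum_(2 <= k < n.+1) lne (Psi g C (y k.-1) (y k))) ->
  limn_esup (fun n : nat => (n%:R^-1)%:E * lne (Lambda D y n 2^-1)) < 0 ->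
  0 < \int[nu]_x Q x (C (y 1%N)) -> 0 < \int[nu']_x Q x (C (y 1%N)) ->
  limn_esup (fun n : nat => (n%:R^-1)%:E *
    lne (tv_norm (filtering_diff Q g nu nu' y n))) < 0.
Proof.
move=> DU M0 hem hU hPsi /limn_esup_lt0[c c0 hL] nuQ nuQ'.
have C1 : exists x, C (y 1%N) x.
  apply/not_existsP => C0; move: nuQ; rewrite (_ : C _ = set0).
    by rewrite integral0_eq ?ltxx.
  by apply/seteqP; split => x // /C0.
have [x0 _] := C1.
have [ups [Hups Uups upsM]] := Upsilon_growth g_gt0 x0 hU.
have [psi [psi0 psiC psiM]] := Psi_growth Hups C1 hPsi.
have emM := LD_em_growth hem.
have mM := mass_growth g_gt0 Hups psi0 psiC psiM emM nuQ.
have mM' := mass_growth g_gt0 Hups psi0 psiC psiM emM nuQ'.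
have Hoff := small_off_Upsilon DU Uups.
set kappa := expR _ in Hoff.
have k0 : (0 <= kappa)%R by exact: expR_ge0.
have k1 : (kappa <= 1)%R by rewrite -expR0 ler_expR; lra.
(* Half of the common rate of the two terms, the other half absorbs the factor 4. *)
pose b : R := (Num.min c 1 / 2)%R.
have b0 : (0 < b)%R by rewrite divr_gt0// lt_min c0 /=.
have bc : (2 * b <= c)%R by rewrite mulrC divfK// ge_min lexx.
have b1 : (2 * b <= 1)%R by rewrite mulrC divfK// ge_min lexx orbT.
apply: (@le_lt_trans _ _ (- b)%:E); last by rewrite lte_fin oppr_lt0.
apply: limn_esup_le_near; near=> n.
have n0 : (0 < n%:R :> R)%R by rewrite ltr0n; near: n; exact: nbhs_infty_gt.
rewrite lee_pdivrMl// -EFinM lne_leE.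
have mn : (expR (- (2 * M + 1) * n%:R) <= mass Q g nu y n setT)%R by near: n.
have mn' : (expR (- (2 * M + 1) * n%:R) <= mass Q g nu' y n setT)%R by near: n.
have mn0 := lt_le_trans (expR_gt0 _) mn.
have mn0' := lt_le_trans (expR_gt0 _) mn'.
apply: le_trans (tv_filtering_le k0 k1 (uphalf n) Hups Hoff mn0 mn0') _.
rewrite lee_fin.
have cn : (contraction D y n (uphalf n) <= expR (- c * n%:R))%R.
  apply: contraction_le_Lambda; first exact: expR_ge0.
  rewrite -lne_leE mulrC EFinM -lee_pdivrMl//; apply: ltW.
  by near: n.
have ler0n2 := ler0n R 2.
have un : (\prod_(k < n.+1) ups k <= expR (M * n%:R))%R by near: n.
have un0 : (0 <= \prod_(k < n.+1) ups k)%R.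
  by apply: prodr_ge0 => k _; exact: likelihood_bound_ge0 x0 _ Hups.
have Kn : (6 * M + 4 <= n%:R)%R by near: n; exact: nbhs_infty_ger.
have bad := rare_visits_rate M0 un0 un mn mn' Kn.
have e1 : (expR (- c * n%:R) <= expR (- (2 * b) * n%:R))%R.
  by rewrite ler_expR ler_wpM2r ?ler0n// lerN2.
have e2 : (expR (- n%:R) <= expR (- (2 * b) * n%:R))%R.
  by rewrite ler_expR mulNr lerN2 -[leRHS]mul1r ler_wpM2r ?ler0n.
apply: le_trans (ler_wpM2l ler0n2 (lerD (le_trans cn e1) (le_trans bad e2))) _.
have n4 : (ln 4 <= b * n%:R)%R by near: n; exact: near_le_scale.
rewrite -ler_expR lnK ?posrE// in n4.
have -> : (n%:R * - b = b * n%:R + - (2 * b) * n%:R)%R by ring.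
rewrite expRD; move: (expR (- (2 * b) * n%:R)) (expR_ge0 (- (2 * b) * n%:R)) => e e0.
rewrite (_ : 2 * (e + e) = 4 * e)%R; last by ring.
by rewrite ler_wpM2r.
Unshelve. all: by end_near. Qed.

End forgetting.

Theorem mainTheorem1 (R : realType)
    (dX dY dO : measure_display)
    (X : measurableType dX) (Y : measurableType dY) (Omega : measurableType dO)
    (hX : countably_generated X) (hY : countably_generated Y)
    (Q : R.-pker X ~> X) (G : R.-pker X ~> Y)
    (mu : {measure set Y -> \bar R}) (g : transition_density G mu)
    (g_gt0 : forall x y, (0 < g x y)%R)
    (Ceta : R -> LD_set_function Y Q)
    (hCeta : forall eta : R, (0 < eta)%R -> forall y : Y,
      Upsilon g (~` Ceta eta y) y <= eta%:E * Upsilon g [set: X] y)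
    (P : probability Omega R) (Yp : nat -> {RV P >-> Y})
    (C : LD_set_function Y Q) (M : R) (M_gt0 : (0 < M)%R)
    (hem : \forall w \ae P,
      (- M)%:E < limn_einf (fun n : nat => (n%:R^-1)%:E *
        \sum_(2 <= k < n.+1) (ln (LD_em C (Yp k.-1 w) (Yp k w)))%:E))
    (hUpsilon : \forall w \ae P,
      limn_esup (fun n : nat => (n%:R^-1)%:E *
        \sum_(0 <= k < n.+1) lne (Upsilon g [set: X] (Yp k w))) < M%:E)
    (hPsi : \forall w \ae P,
      (- M)%:E < limn_einf (fun n : nat => (n%:R^-1)%:E *
        \sum_(2 <= k < n.+1) lne (Psi g C (Yp k.-1 w) (Yp k w))))
    (hLambda : forall eta alpha : R,
      (0 < eta)%R -> (0 < alpha)%R -> (alpha < 1)%R ->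
      \forall w \ae P,
        limn_esup (fun n : nat => (n%:R^-1)%:E *
          lne (Lambda (Ceta eta) (fun k => Yp k w) n alpha)) < 0)
    (nu nu' : probability X R)
    (hnu : \forall w \ae P, 0 < \int[nu]_x Q x (C (Yp 1%N w)))
    (hnu' : \forall w \ae P, 0 < \int[nu']_x Q x (C (Yp 1%N w))) :
  \forall w \ae P,
    limn_esup (fun n : nat => (n%:R^-1)%:E *
      lne (tv_norm (filtering_diff Q g nu nu' (fun k => Yp k w) n))) < 0.
Proof.
pose eta : R := (expR (- (12 * M + 8)) ^+ 2)%R.
have eta0 : (0 < eta)%R by rewrite exprn_gt0// expR_gt0.
have half0 : (0 < 2^-1 :> R)%R by rewrite invr_gt0.
have half1 : (2^-1 < 1 :> R)%R by rewrite invf_lt1// ltr1n.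
have hL := hLambda eta 2^-1%R eta0 half0 half1.
move: hnu'; apply: filter_app; move: hnu; apply: filter_app.
move: hL; apply: filter_app; move: hPsi; apply: filter_app.
move: hUpsilon; apply: filter_app; move: hem; apply: filterS.
move=> w em U Psi_ L nuQ nuQ'.
exact: (filter_forgetting (y := fun k => Yp k w) g_gt0 (hCeta eta eta0) M_gt0
  em U Psi_ L nuQ nuQ').
Qed.
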